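(* Let $K$ be a field, $S=K[x_1,\dots,x_n]$, and let $I\subset S$ be a (nonzero) matching-matroidal ideal of Veronese type. Then $I^{(k)}$ has linear quotients and $\mathrm{reg}\,I^{(k)}=\mathrm{reg}\,I^k$ for all $k\ge1$.
   Context: For $\emptyset\neq F\subseteq[n]=\{1,\dots,n\}$ let $P_F=(x_i:i\in F)$. For a monomial ideal $L\subset S$, its squarefree part $L^{\le{\bf1}}$ is the ideal generated by all squarefree monomials in $L$. A finite collection $\mathcal{A}=\{A_1,\dots,A_t\}$ of non-empty subsets of $[n]$ (repetitions allowed) is of *Veronese type* if $A_i\cap A_j\neq\emptyset$ implies $A_i=A_j$. A *matching-matroidal ideal of Veronese type* is an ideal $I=(P_{A_1}\cdots P_{A_t})^{\le{\bf1}}$ with $\{A_1,\dots,A_t\}$ of Veronese type. $S$ is standard graded; $\mathrm{reg}$ is Castelnuovo–Mumford regularity. The $k$th symbolic power is $I^{(k)}=\bigcap_{P\in\mathrm{Ass}(I)}(I^kS_P\cap S)$, with $\mathrm{Ass}(I)=\mathrm{Ass}(S/I)$. A monomial ideal $L$ has linear quotients if its minimal monomial generators can be ordered $u_1,\dots,u_s$ so that $(u_1,\dots,u_{i-1}):(u_i)$ is generated by variables for $i=2,\dots,s$. *)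

(* Defs.v *)
From HB Require Import structures.
From mathcomp Require Import all_boot all_order all_algebra.
From mathcomp Require Import fraction.
From mathcomp Require Import mpoly.
From mathcomp Require Import boolp classical_sets.

Set Implicit Arguments.
Unset Strict Implicit.
Unset Printing Implicit Defensive.

Import GRing.Theory.

Local Open Scope classical_set_scope.
Local Open Scope ring_scope.

Section Ideals.
Variables (K : fieldType) (n : nat).
Local Notation S := {mpoly K[n]}.

Definition is_ideal (I : set S) : Prop :=
  [/\ I 0, forall f g, I f -> I g -> I (f + g)
    & forall f g, I g -> I (f * g)].

Definition idgen (G : set S) : set S := smallest is_ideal G.

Definition idmul (I J : set S) : set S :=
  idgen [set f * g | f in I & g in J].

(* The unit ideal S is [setT], so I^0 = S. *)
Definition idpow (I : set S) (k : nat) : set S := iter k (idmul I) setT.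

Definition colon (I : set S) (f : S) : set S := [set g | I (g * f)].

Definition is_prime (P : set S) : Prop :=
  [/\ is_ideal P, ~ P 1 & forall f g, P (f * g) -> P f \/ P g].

(* Ass(S/I): the primes that are annihilators of a class f + I. *)
Definition Ass (I : set S) : set (set S) :=
  [set P | is_prime P /\ exists f : S, P = colon I f].

(* J S_P, inside Frac S (S is a domain). *)
Definition idloc (J P : set S) : set {fraction S} :=
  [set tofrac a / tofrac s | a in J & s in ~` P].

Definition symbolic_power (I : set S) (k : nat) : set S :=
  \bigcap_(P in Ass I) (@tofrac S @^-1` idloc (idpow I k) P).

Definition varideal (F : {set 'I_n}) : set S := idgen [set 'X_i | i in [set` F]].

Definition squarefree_part (L : set S) : set S :=
  idgen [set f | L f /\
    exists2 m : 'X_{1..n}, (forall i, (m i <= 1)%N) & f = 'X_[m]].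

Definition veronese_type (t : nat) (A : 'I_t -> {set 'I_n}) : Prop :=
  (forall i, A i != finset.set0) /\
  (forall i j, (A i :&: A j)%SET != finset.set0 -> A i = A j).

Definition matching_matroidal_veronese (I : set S) : Prop :=
  exists (t : nat) (A : 'I_t -> {set 'I_n}),
    veronese_type A /\
    I = squarefree_part (\big[idmul/setT]_(i < t) varideal (A i)).

Definition monideal (us : seq 'X_{1..n}) : set S :=
  idgen [set 'X_[u] | u in [set` us]].

Definition minimal_monomial_generators (L : set S) (us : seq 'X_{1..n}) :
    Prop :=
  [/\ uniq us, L = monideal us
    & forall u, u \in us -> monideal (rem u us) <> L].

Definition has_linear_quotients (L : set S) : Prop :=
  exists2 us : seq 'X_{1..n}, minimal_monomial_generators L us
  & forall i, (0 < i < size us)%N ->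
      exists F : {set 'I_n},
        colon (monideal (take i us)) 'X_[nth 0%MM us i] = varideal F.

(* f is zero or homogeneous of degree d. *)
Definition is_homog (d : int) (f : S) : Prop :=
  forall m, m \in msupp f -> (mdeg m)%:Z = d.

(* Minimal graded free resolution  ... -> F_1 -> F_0 -> J -> 0  of an ideal J,
   with F_i = (+)_p S(- shift i p).  Elements of F_i are row vectors, so the
   differential F_(i+1) -> F_i is right multiplication by [dif i], and
   F_0 -> J is right multiplication by [aug].  Minimality is
   dif(F_(i+1)) \subset (x_1, ..., x_n) F_i. *)
Record min_graded_free_resolution (J : set S) := MinGradedFreeResolution {
  rk : nat -> nat;
  shift : forall i, 'I_(rk i) -> int;
  aug : 'cV[S]_(rk 0);
  dif : forall i, 'M[S]_(rk i.+1, rk i);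
  aug_homog : forall p, is_homog (shift p) (aug p 0);
  dif_homog : forall i p q, is_homog (shift p - shift q) (dif i p q);
  aug_image : forall f, J f <-> exists v : 'rV_(rk 0), v *m aug = f%:M;
  aug_exact : forall v : 'rV_(rk 0),
    v *m aug = 0 <-> exists w, v = w *m dif 0;
  dif_exact : forall i (v : 'rV_(rk i.+1)),
    v *m dif i = 0 <-> exists w, v = w *m dif i.+1;
  dif_minimal : forall i p q, (dif i p q)@_0%MM = 0
}.

(* reg J = r, i.e. r = max {j - i : beta_(i,j)(J) <> 0}. *)
Definition is_reg (J : set S) (r : int) : Prop :=
  exists F : min_graded_free_resolution J,
    (forall i (p : 'I_(rk F i)), (shift p - i%:Z <= r)%R) /\
    (exists i (p : 'I_(rk F i)), shift p - i%:Z = r).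

End Ideals.

(* Main.v *)
Require Import Defs.
From HB Require Import structures.
From mathcomp Require Import all_boot all_order all_algebra.
From mathcomp Require Import fraction mpoly zify.
From mathcomp Require Import boolp classical_sets.

Set Implicit Arguments.
Unset Strict Implicit.
Unset Printing Implicit Defensive.

Import Order.TTheory GRing.Theory.

Local Open Scope classical_set_scope.
Local Open Scope ring_scope.

(* Merging repeated factors, I is given by disjoint blocks B with multiplicities d(B): a monomial
   x^m lies in I iff m is positive on at least d(B) elements of every block B.  Hence x^m lies in
   I^k iff \sum_(x in B) min(m x, k) >= k d(B) for every B, while Ass(I) consists of the P_F with
   F in a block B and |F| = |B| - d(B) + 1, so that x^m lies in I^(k) iff
   \sum_(x in F) m x >= k for all such F.

   A minimal generator u of I^(k) restricted to a block B of maximal exponent M has degree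
   k + (d(B) - 1) M, and x_p u / x_q lies in I^(k) whenever u p < u q = M.  Order the generators by
   degree, then by the sum of the squares of the exponents, then lexicographically: if v precedes u,
   some such swap with u p < v p precedes u as well, which gives linear quotients.  For I^k, which
   is generated in one degree, the lexicographic order suffices.

   An ideal with linear quotients along generators of nondecreasing degree is resolved by iterated
   mapping cones over Koszul complexes.  The comparison maps have entries of positive degree, so the
   resolution is minimal and the regularity is the largest degree of a generator, which is
   k \sum_B d(B) for both ideals. *)

(** * Monomial ideals *)

Section MonomialIdeals.
Variables (K : fieldType) (n : nat).
Local Notation S := {mpoly K[n]}.
Implicit Types (f g : S) (m u : 'X_{1..n}) (P Q : 'X_{1..n} -> Prop).

(** The [K]-span of the monomials with exponent in [P], an ideal once [P] is upward closed. In this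
    form, an equality of monomial ideals becomes an equivalence of predicates on exponents. *)
Definition mideal P : set S := [set f | forall m, m \in msupp f -> P m].

Definition upclosed P := forall m u, P m -> (m <= u)%MM -> P u.

Lemma msuppDP f g m : m \in msupp (f + g) -> m \in msupp f \/ m \in msupp g.
Proof. by move/msuppD_le; rewrite mem_cat => /orP. Qed.

Lemma msuppMP f g m : m \in msupp (f * g) ->
  exists m1 m2, [/\ m1 \in msupp f, m2 \in msupp g & m = (m1 + m2)%MM].
Proof. by move/msuppM_le/allpairsP => [[m1 m2] [h1 h2 ->]]; exists m1, m2. Qed.

Lemma mideal_ideal P : upclosed P -> is_ideal (mideal P).
Proof.
move=> uP; split=> [m | f g Pf Pg m | f g Pg m]; first by rewrite msupp0.
- by move/msuppDP => [/Pf | /Pg].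
- by move/msuppMP => [m1 [m2 [_ /Pg Pm ->]]]; apply: uP Pm _; exact: lem_addl.
Qed.

Lemma midealX P m : mideal P 'X_[m] <-> P m.
Proof.
by split=> [|Pm u /mem_msuppXP <- //]; apply; rewrite msuppX mem_head.
Qed.

Lemma idealS (J : set S) : is_ideal J -> forall P,
  (forall m, P m -> J 'X_[m]) -> mideal P `<=` J.
Proof.
case=> J0 JD JM P PJ f Pf; rewrite (mpolyE f).
rewrite big_seq; elim/big_ind: _ => // m /Pf/PJ Jm.
by rewrite -mul_mpolyC; exact: JM.
Qed.

Lemma idgen_ideal (G : set S) : is_ideal (idgen G).
Proof.
split=> [J [[J0 _ _] _] // | f g If Ig J HJ | f g Ig J HJ].
- by have [[_ JD _] _] := HJ; apply: JD; [exact: If | exact: Ig].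
- by have [[_ _ JM] _] := HJ; apply: JM; exact: Ig.
Qed.

Lemma sub_idgen (G : set S) : G `<=` idgen G.
Proof. exact: sub_smallest. Qed.

Lemma idgen_min (G J : set S) : is_ideal J -> G `<=` J -> idgen G `<=` J.
Proof. by move=> iJ GJ f; apply. Qed.

Lemma idgen_mideal (G : set S) P : upclosed P -> G `<=` mideal P ->
  (forall m, P m -> idgen G 'X_[m]) -> idgen G = mideal P.
Proof.
move=> uP GP PG; apply/seteqP; split.
- by apply: idgen_min => //; exact: mideal_ideal.
- by apply: idealS => //; exact: idgen_ideal.
Qed.

Lemma eq_mideal P Q : (forall m, P m <-> Q m) -> mideal P = mideal Q.
Proof. by move=> PQ; congr mideal; apply/funext => m; apply/propext. Qed.

Lemma mideal_setT : mideal (fun=> True) = setT.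
Proof. by apply/seteqP; split. Qed.

Lemma idmul_mideal P Q R : upclosed R ->
  (forall m u, P m -> Q u -> R (m + u)%MM) ->
  (forall m, R m -> exists m1 m2, [/\ P m1, Q m2 & m = (m1 + m2)%MM]) ->
  idmul (mideal P) (mideal Q) = mideal R.
Proof.
move=> uR PQR RPQ; apply: idgen_mideal => //.
- move=> _ [f Pf [g Qg <-]] m /msuppMP [m1 [m2 [/Pf h1 /Qg h2 ->]]].
  exact: PQR.
- move=> m /RPQ [m1 [m2 [h1 h2 ->]]]; rewrite mpolyXD.
  apply: sub_idgen; exists 'X_[m1]; first by apply/midealX.
  by exists 'X_[m2] => //; apply/midealX.
Qed.

Lemma monidealE (us : seq 'X_{1..n}) :
  (monideal us : set S) = mideal (fun m => exists2 u, u \in us & (u <= m)%MM).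
Proof.
apply: idgen_mideal => [m u [v vus vm] mu | | m [u uus um]].
- by exists v => //; exact: lepm_trans mu.
- by move=> _ [u uus <-]; apply/midealX; exists u => //; exact: lepm_refl.
- rewrite -(submK um) mpolyXD; have [_ _ idM] := idgen_ideal
    [set 'X_[K, u] | u in [set` us]].
  by apply: idM; apply: sub_idgen; exists u.
Qed.

Lemma varidealE (F : {set 'I_n}) :
  (varideal F : set S) = mideal (fun m => exists2 i, i \in F & m i != 0%N).
Proof.
apply: idgen_mideal => [m u [i iF mi] /mnm_lepP/(_ i) | | m [i iF mi]].
- by move=> mu; exists i => //; rewrite -lt0n (leq_trans _ mu) // lt0n.
- by move=> _ [i iF <-]; apply/midealX; exists i => //; rewrite mnm1E eqxx.
- have um : (U_(i) <= m)%MM by rewrite lep1mP.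
  rewrite -(submK um) mpolyXD; have [_ _ idM] := idgen_ideal
    [set ('X_i : S) | i in [set` F]].
  by apply: idM; apply: sub_idgen; exists i.
Qed.

Lemma midealMX P m f : mideal P (f * 'X_[m]) <-> mideal (fun u => P (m + u)%MM) f.
Proof.
split=> Pf u.
  rewrite mcoeff_msupp => fu; apply: Pf.
  by rewrite mcoeff_msupp mcoeffMX.
by move/msuppMP => [m1 [m2 [/Pf h1 /mem_msuppXP <- ->]]]; rewrite addmC.
Qed.

(** * Homogeneous components for an additive weight *)

Section WeightParts.
Variable w : 'X_{1..n} -> int.

(** The weight is left open: it is the total degree when maps of graded modules are lifted, and the
    degree in the variables of [F] when powers of [P_F] are shown to be primary. It is an integer
    because differences of shifts can be negative. *)
Definition wpart (e : int) f : S :=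
  \sum_(m <- msupp f | w m == e) f@_m *: 'X_[m].

Lemma mcoeff_wpart e f m : (wpart e f)@_m = if w m == e then f@_m else 0.
Proof.
rewrite /wpart raddf_sum /= big_mkcond /=.
have [mf | /memN_msupp_eq0 fm0] := boolP (m \in msupp f).
- rewrite (bigD1_seq m) ?msupp_uniq //= big1 ?addr0 => [|u um].
    by case: (_ == e); rewrite ?mcoeff0 // mcoeffZ mcoeffX eqxx mulr1.
  by case: (_ == e); rewrite ?mcoeff0 // mcoeffZ mcoeffX (negbTE um) mulr0.
- rewrite fm0 if_same; apply: big1_seq => u /andP[_ uf].
  case: (_ == e); rewrite ?mcoeff0 // mcoeffZ mcoeffX.
  case: eqP => [eum|]; last by rewrite mulr0.
  by rewrite eum fm0 mul0r.
Qed.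

Lemma msupp_wpart e f m : m \in msupp (wpart e f) -> w m = e.
Proof.
by rewrite mcoeff_msupp mcoeff_wpart; case: (w m =P e) => //; rewrite eqxx.
Qed.

Fact wpart_is_additive e : additive (wpart e).
Proof.
move=> f g; apply/mpolyP => m; rewrite mcoeffB !mcoeff_wpart mcoeffB.
by case: ifP; rewrite ?subr0.
Qed.

HB.instance Definition _ e :=
  GRing.isAdditive.Build S S (wpart e) (wpart_is_additive e).

Lemma wpart_id e f : (forall m, m \in msupp f -> w m = e) -> wpart e f = f.
Proof.
move=> fe; apply/mpolyP => m; rewrite mcoeff_wpart.
have [/fe ->|/memN_msupp_eq0 ->] := boolP (m \in msupp f); first by rewrite eqxx.
by rewrite if_same.
Qed.

Lemma wpart_eq0 e f : (forall m, m \in msupp f -> w m <> e) -> wpart e f = 0.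
Proof.
move=> fe; apply/mpolyP => m; rewrite mcoeff_wpart mcoeff0.
have [/fe/eqP/negbTE ->//|/memN_msupp_eq0 ->] := boolP (m \in msupp f).
by rewrite if_same.
Qed.

Hypothesis wD : forall m u, w (m + u)%MM = w m + w u.

Lemma wpartM e c f g : (forall m, m \in msupp g -> w m = c) ->
  wpart (e + c) (f * g) = wpart e f * g.
Proof.
move=> gc; rewrite {1}(mpolyE f) mulr_suml raddf_sum /= /wpart mulr_suml.
rewrite [RHS]big_mkcond /=; apply: eq_bigr => m _.
have wfg u : u \in msupp (f@_m *: 'X_[m] * g) -> w u = w m + c.
  case/msuppMP => [m1 [m2 [/msuppZ_le/mem_msuppXP <- /gc gm2 ->]]].
  by rewrite wD gm2.
rewrite -/(wpart _ _); case: eqP => [<-|wme]; first exact: wpart_id.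
by apply: wpart_eq0 => u /wfg ->; move/addIr.
Qed.

End WeightParts.

End MonomialIdeals.

(** * Resolutions *)

Section HomogeneousLifting.
Variables (K : fieldType) (n : nat).
Local Notation S := {mpoly K[n]}.
Implicit Types (f g : S) (d e : int).

Local Notation hpart := (@wpart K n (fun m => (mdeg m)%:Z)).

Lemma mdegzD (m u : 'X_{1..n}) : (mdeg (m + u))%:Z = (mdeg m)%:Z + (mdeg u)%:Z.
Proof. by rewrite mdegD PoszD. Qed.

Lemma is_homog0 d : is_homog d (0 : S).
Proof. by move=> m; rewrite msupp0. Qed.

Lemma is_homogN d f : is_homog d f -> is_homog d (- f).
Proof. by move=> hf m; rewrite (perm_mem (msuppN f)); exact: hf. Qed.

Lemma is_homog_sum d (I : Type) (r : seq I) (Q : pred I) (F : I -> S) :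
  (forall i, Q i -> is_homog d (F i)) -> is_homog d (\sum_(i <- r | Q i) F i).
Proof.
move=> hF; elim/big_ind: _ => //; first exact: is_homog0.
by move=> f g hf hg m /msuppDP[/hf|/hg].
Qed.

Lemma is_homogM d e f g : is_homog d f -> is_homog e g -> is_homog (d + e) (f * g).
Proof.
by move=> hf hg m /msuppMP [m1 [m2 [/hf <- /hg <- ->]]]; rewrite mdegD PoszD.
Qed.

(** Replace each entry of any preimage by its component of degree [e - a i]. As [D] is homogeneous,
    each entry of the image is replaced by its component of degree [e - b j], which leaves [w]
    unchanged. *)
Lemma homogeneous_lift p q (D : 'M[S]_(p, q)) (a : 'I_p -> int)
    (b : 'I_q -> int) (e : int) (w : 'rV_q) :
  (forall i j, is_homog (a i - b j) (D i j)) ->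
  (forall j, is_homog (e - b j) (w 0 j)) ->
  (exists v, w = v *m D) ->
  exists2 v : 'rV_p, (forall i, is_homog (e - a i) (v 0 i)) & w = v *m D.
Proof.
move=> hD hw [v wE]; exists (\row_i hpart (e - a i) (v 0 i)).
  by move=> i m; rewrite mxE => /msupp_wpart.
apply/rowP => j; rewrite -[LHS](wpart_id (hw j)) {1}wE !mxE raddf_sum /=.
apply: eq_bigr => i _; rewrite mxE -(wpartM mdegzD _ _ (hD i j)).
by congr wpart; rewrite addrA subrK.
Qed.

Lemma mulmx_lift p q r (D : 'M[S]_(p, q)) (B : 'M[S]_(r, q)) :
  (forall i, exists v, row i B = v *m D) -> exists A, B = A *m D.
Proof.
move=> BD; exists (\matrix_i sval (cid (BD i))).
by apply/row_matrixP => i; rewrite row_mul rowK; case: (cid _).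
Qed.

End HomogeneousLifting.

Section Resolutions.
Variables (K : fieldType) (n : nat) (J : set {mpoly K[n]}).
Variable G : min_graded_free_resolution J.

Lemma dif_augK : dif G 0 *m aug G = 0.
Proof.
apply/row_matrixP => i; rewrite row_mul row0.
by apply/aug_exact; exists (delta_mx 0 i); rewrite -rowE.
Qed.

Lemma dif_difK i : dif G i.+1 *m dif G i = 0.
Proof.
apply/row_matrixP => p; rewrite row_mul row0.
by apply/dif_exact; exists (delta_mx 0 p); rewrite -rowE.
Qed.

End Resolutions.

(** * The mapping cone that adds a generator [u] to [J] *)

Section Cone.
Variables (K : fieldType) (n : nat).
Local Notation S := {mpoly K[n]}.
Variables (J P : set S) (u : S) (d : int).
Variables (G : min_graded_free_resolution J) (H : min_graded_free_resolution P).
Hypothesis u_homog : is_homog d u.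
Hypothesis colonJu : forall g, P g <-> J (g * u).

(** The resolution of [S/P]: [S] in position 0, then [H] moved up by one, so that the augmentation
    of [H] becomes the first differential. *)
Definition erk i := if i is j.+1 then rk H j else 1%N.

Definition edif i : 'M[S]_(erk i.+1, erk i) :=
  match i with 0 => aug H | j.+1 => dif H j end.

Definition eshift i : 'I_(erk i) -> int :=
  match i with 0 => fun=> 0 | j.+1 => @shift _ _ _ H j end.

Lemma edif_homog i p q : is_homog (eshift p - eshift q) (@edif i p q).
Proof.
case: i p q => [|i] p q /=; last exact: dif_homog.
by rewrite subr0 (ord1 q); exact: aug_homog.
Qed.

Lemma edif_exact i (v : 'rV[S]_(rk H i)) :
  v *m @edif i = 0 <-> exists w, v = w *m dif H i.
Proof. by case: i v => [|i] v; [exact: aug_exact | exact: dif_exact]. Qed.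

Section ComparisonMap.

(** The invariant of the recursive lifting: the rows of [dif H i *m phi] are boundaries of [G], as
    the choice of the next map requires. *)
Definition liftable i (phi : 'M[S]_(rk H i, rk G i)) : Prop :=
  (forall p q, is_homog (shift p + d - shift q) (phi p q)) /\
  exists psi, dif H i *m phi = psi *m dif G i.

(** [u] times a generator of [P] lies in [J] because [P] is the colon of [J] by [u], so it lifts
    along [aug G]. The invariant follows from exactness of [G], since [dif H 0 *m aug H]
    vanishes. *)
Lemma lift_start : exists2 phi, liftable (phi : 'M[S]_(rk H 0, rk G 0)) &
  u *: aug H = phi *m aug G.
Proof.
have hu (p : 'I_(rk H 0)) (j : 'I_1) :
    is_homog (shift p + d - 0) ((row p (u *: aug H)) 0 j).
  rewrite subr0 !mxE (ord1 j) addrC; apply: is_homogM => //; exact: aug_homog.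
have hG (i : 'I_(rk G 0)) (j : 'I_1) : is_homog (shift i - 0) (aug G i j).
  by rewrite subr0 (ord1 j); exact: aug_homog.
have ex (p : 'I_(rk H 0)) : exists v, row p (u *: aug H) = v *m aug G.
  have : P (aug H p 0).
    apply/(aug_image H); exists (delta_mx 0 p).
    by rewrite -rowE; apply/rowP => j; rewrite !mxE (ord1 j) eqxx mulr1n.
  move/colonJu/(aug_image G) => [v vE]; exists v; rewrite vE.
  by apply/rowP => j; rewrite !mxE (ord1 j) eqxx mulr1n mulrC.
have {}ex p := cid2 (homogeneous_lift hG (hu p) (ex p)).
exists (\matrix_p s2val (ex p)); last first.
  by apply/row_matrixP => p; rewrite [RHS]row_mul rowK; case: (ex p).
split=> [p q|]; first by rewrite mxE; case: (ex p).
have phiE : u *: aug H = \matrix_p s2val (ex p) *m aug G.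
  by apply/row_matrixP => p; rewrite [RHS]row_mul rowK; case: (ex p).
apply: mulmx_lift => p; rewrite row_mul; apply/aug_exact.
by rewrite -mulmxA -phiE -scalemxAr -row_mul dif_augK row0 scaler0.
Qed.

Lemma lift_step i (phi : 'M[S]_(rk H i, rk G i)) : liftable phi ->
  exists2 psi : 'M[S]_(rk H i.+1, rk G i.+1), liftable psi &
    dif H i *m phi = psi *m dif G i.
Proof.
move=> [hphi [psi0 psi0E]].
have hrow (p : 'I_(rk H i.+1)) (j : 'I_(rk G i)) :
    is_homog (shift p + d - shift j) ((row p (dif H i *m phi)) 0 j).
  rewrite !mxE; apply: is_homog_sum => q _.
  have -> : shift p + d - shift j = (shift p - shift q) + (shift q + d - shift j).
    by rewrite -!addrA addKr.
  by apply: is_homogM => //; exact: dif_homog.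
have ex (p : 'I_(rk H i.+1)) : exists v, row p (dif H i *m phi) = v *m dif G i.
  by exists (row p psi0); rewrite psi0E row_mul.
have {}ex p := cid2 (homogeneous_lift (@dif_homog _ _ _ G i) (hrow p) (ex p)).
have phiE : dif H i *m phi = \matrix_p s2val (ex p) *m dif G i.
  by apply/row_matrixP => p; rewrite [RHS]row_mul rowK; case: (ex p).
exists (\matrix_p s2val (ex p)) => //.
split=> [p q|]; first by rewrite mxE; case: (ex p).
apply: mulmx_lift => p; rewrite row_mul; apply/dif_exact.
by rewrite -mulmxA -phiE mulmxA -row_mul dif_difK row0 mul0mx.
Qed.

(** Each map is chosen after its predecessor, so the witnesses are extracted inside a recursion that
    carries the invariant. *)
Fixpoint lift_seq i : {phi : 'M[S]_(rk H i, rk G i) | liftable phi} :=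
  match i with
  | 0 => let: exist2 phi h _ := cid2 lift_start in exist _ phi h
  | j.+1 => let: exist phi h := lift_seq j in
            let: exist2 psi h' _ := cid2 (lift_step h) in exist _ psi h'
  end.

Lemma comparison_map : exists phi : forall i, 'M[S]_(rk H i, rk G i),
  [/\ forall i p q, is_homog (shift p + d - shift q) (phi i p q),
      u *: aug H = phi 0%N *m aug G
    & forall i, dif H i *m phi i = phi i.+1 *m dif G i].
Proof.
exists (fun i => sval (lift_seq i)); split=> [i p q||i].
- by case: (lift_seq i) => phi [].
- by rewrite /=; case: (cid2 _).
- by rewrite /=; case: (lift_seq i) => phi h /=; case: (cid2 _).
Qed.

End ComparisonMap.

Variable phi : forall i, 'M[S]_(rk H i, rk G i).
Hypothesis phi_homog :
  forall i p q, is_homog (shift p + d - shift q) (phi i p q).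
Hypothesis phi0 : u *: aug H = phi 0 *m aug G.
Hypothesis phiS : forall i, dif H i *m phi i = phi i.+1 *m dif G i.
Hypothesis phi_minimal : forall i p q, (phi i p q)@_0%MM = 0.
Hypothesis P_minimal : forall f, P f -> f@_0%MM = 0.

Definition crk i := (rk G i + erk i)%N.

Definition cshift i (p : 'I_(crk i)) : int :=
  match split p with inl a => shift a | inr b => eshift b + d end.

Definition caug : 'cV[S]_(crk 0) := col_mx (aug G) u%:M.

(** Since vectors are rows, [phi i] sends the copy of [H] in position [i.+1] to [G] in position [i].
    The sign on [edif] makes consecutive differentials compose to zero. *)
Definition cdif i : 'M[S]_(crk i.+1, crk i) :=
  block_mx (dif G i) 0 (phi i) (- edif i).

Fact caug_homog p : is_homog (cshift p) (caug p 0).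
Proof.
rewrite /cshift mxE; case: split => a /=; first exact: aug_homog.
by rewrite mxE (ord1 a) eqxx mulr1n add0r.
Qed.

Fact cdif_homog i p q : is_homog (cshift p - cshift q) (@cdif i p q).
Proof.
rewrite /cshift /cdif mxE; case: (split p) => a; rewrite mxE; case: (split q) => b.
- exact: dif_homog.
- by rewrite mxE; exact: is_homog0.
- exact: phi_homog.
- rewrite mxE; apply: is_homogN.
  by rewrite opprD addrACA subrr addr0; exact: edif_homog.
Qed.

Fact caug_image f :
  [set g + h * u | g in J & h in setT] f <-> exists v, v *m caug = f%:M.
Proof.
split=> [[g /(aug_image G) [v vE] [h _ <-]] | [v]].
  exists (row_mx v h%:M); rewrite mul_row_col vE -scalar_mxM.
  by apply/rowP => j; rewrite !mxE (ord1 j) !eqxx !mulr1n.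
rewrite -[v]hsubmxK mul_row_col [rsubmx v]mx11_scalar -scalar_mxM => vE.
exists ((lsubmx v *m aug G) 0 0).
  by apply/(aug_image G); exists (lsubmx v); rewrite -mx11_scalar.
exists (rsubmx v 0 0) => //.
by move/rowP/(_ 0): vE; rewrite !mxE eqxx !mulr1n.
Qed.

(** If [v *m caug = 0], then the last entry of [v] times [u] lies in [J], so that entry lies in [P]
    and equals [w *m aug H] for some [w]. Adding [w *m phi 0] to the other entries gives a vector
    killed by [aug G], hence a boundary. [cdif_exact] is the same chase one step higher. *)
Fact caug_exact (v : 'rV[S]_(crk 0)) : v *m caug = 0 <-> exists w, v = w *m cdif 0.
Proof.
split=> [|[w ->]]; last first.
  rewrite -mulmxA /caug /cdif mul_block_col mul0mx addr0 mulNmx /=.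
  by rewrite dif_augK -phi0 mul_mx_scalar subrr col_mx0 mulmx0.
rewrite -[v]hsubmxK mul_row_col.
set v1 := lsubmx v; set v2 := rsubmx v => vE.
have /(aug_image H) [w wE] : P (v2 0 0).
  apply/colonJu/(aug_image G); exists (- v1).
  rewrite mulNmx scalar_mxM -mx11_scalar.
  by apply/eqP; rewrite eqr_oppLR -addr_eq0 vE.
have v2E : v2 = w *m aug H by rewrite wE -mx11_scalar.
have [w1 w1E] : exists w1, v1 + w *m phi 0 = w1 *m dif G 0.
  apply/aug_exact; rewrite mulmxDl -mulmxA -phi0 -scalemxAr -v2E.
  by rewrite -mul_mx_scalar.
exists (row_mx w1 (- w)); rewrite mul_row_block mulmx0 add0r !mulNmx mulmxN.
by rewrite opprK -w1E addrK v2E.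
Qed.

Fact cdif_exact i (v : 'rV[S]_(crk i.+1)) : v *m cdif i = 0 <-> exists w, v = w *m cdif i.+1.
Proof.
split=> [|[w ->]]; last first.
  have edifK : edif i.+1 *m edif i = 0.
    by case: i {v w} => [|i]; [exact: dif_augK | exact: dif_difK].
  rewrite -mulmxA /cdif mulmx_block !mul0mx !mulmx0 !addr0 !add0r dif_difK.
  rewrite !mulNmx mulmxN opprK edifK -phiS /= subrr.
  by rewrite -[block_mx _ _ _ _]/(block_mx 0 0 0 0) block_mx0 mulmx0.
rewrite -[v]hsubmxK mul_row_block.
set v1 := lsubmx v; set v2 := rsubmx v : 'rV_(rk H i).
rewrite mulmx0 add0r => /eqP; rewrite row_mx_eq0 => /andP[/eqP v12 /eqP].
rewrite mulmxN => /eqP; rewrite oppr_eq0 => /eqP/edif_exact [w wE].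
have [w1 w1E] : exists w1, v1 + w *m phi i.+1 = w1 *m dif G i.+1.
  by apply/dif_exact; rewrite mulmxDl -mulmxA -phiS mulmxA -wE.
exists (row_mx w1 (- w)); rewrite mul_row_block mulmx0 add0r !mulNmx mulmxN.
by rewrite opprK -w1E addrK -wE.
Qed.

(** The augmentation of [H] has become a differential; its entries lie in [P], so [P_minimal]
    removes their constant terms. *)
Fact cdif_minimal i p q : (@cdif i p q)@_0%MM = 0.
Proof.
rewrite /cdif mxE; case: (split p) => a; rewrite mxE; case: (split q) => b.
- exact: dif_minimal.
- by rewrite mxE mcoeff0.
- exact: phi_minimal.
- rewrite mxE mcoeffN; apply/eqP; rewrite oppr_eq0; apply/eqP.
  case: i {p q} a b => [|i] a b /=; last exact: dif_minimal.
  apply: P_minimal; apply/(aug_image H); exists (delta_mx 0 a).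
  by rewrite -rowE; apply/rowP => j; rewrite !mxE !ord1 eqxx mulr1n.
Qed.

Definition cone_resolution :
    min_graded_free_resolution [set g + h * u | g in J & h in setT] :=
  MinGradedFreeResolution caug_homog cdif_homog caug_image caug_exact
    cdif_exact cdif_minimal.

End Cone.

(** * Iterated mapping cones and regularity *)

Section LinearQuotientsResolution.
Variables (K : fieldType) (n : nat).
Local Notation S := {mpoly K[n]}.
Implicit Types (J P : set S) (u m : 'X_{1..n}) (D : set nat).

(** [D] collects the values of shift minus homological position. Each is attained already by a
    generator, so the regularity is the maximum of [D]. *)
Definition resolved_in J D := exists F : min_graded_free_resolution J,
  (forall i (p : 'I_(rk F i)), exists2 d, D d & shift p = (d + i)%N%:Z) /\
  (forall d, D d -> exists p : 'I_(rk F 0), shift p = d%:Z).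

Definition linear_resolution P := exists F : min_graded_free_resolution P,
  forall i (p : 'I_(rk F i)), shift p = i.+1%:Z.

(** A non-zero entry of the comparison map has degree [(i + 1) + d - (d' + i) = 1 + d - d'], which
    is positive because [d' <= d]. The cone is therefore minimal, and its new shifts form a linear
    strand starting at [d]. *)
Lemma resolved_cone J P (u : S) (d : nat) D :
  is_homog d u -> (forall g, P g <-> J (g * u)) -> (forall f, P f -> f@_0%MM = 0) ->
  (forall d', D d' -> (d' <= d)%N) ->
  resolved_in J D -> linear_resolution P ->
  resolved_in [set g + h * u | g in J & h in setT] (D `|` [set d]).
Proof.
move=> hu colonJu P0 Dd [G [Gshift Gtop]] [H Hshift].
have [phi [hphi phi0 phiS]] := comparison_map G H hu colonJu.
have phi_min i (p : 'I_(rk H i)) (q : 'I_(rk G i)) : (phi i p q)@_0%MM = 0.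
  apply/eqP; rewrite mcoeff_eq0; apply/negP => /hphi; rewrite mdeg0.
  rewrite Hshift; have [d' /Dd dd' ->] := Gshift i q.
  by lia.
exists (cone_resolution hu colonJu hphi phi0 phiS phi_min P0).
split=> [i p /=|d'].
  rewrite /cshift; case: (split p) => a.
    by have [d' Dd' ->] := Gshift i a; exists d' => //; left.
  exists d; first by right.
  case: i a {p} => [|i] a /=; first by rewrite add0r addn0.
  by rewrite Hshift; lia.
move=> [/Gtop [p <-] | ->].
  by exists (lshift (erk H 0) p); rewrite /= /cshift (unsplitK (inl p)).
exists (rshift (rk G 0) (ord0 : 'I_(erk H 0))).
by rewrite /= /cshift (unsplitK (inr _)) add0r.
Qed.

Lemma resolved0 : resolved_in (mideal (fun=> False) : set S) set0.
Proof.
have h0 m : m \in msupp (0 : S) -> False by rewrite msupp0.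
unshelve eexists (@MinGradedFreeResolution K n _ (fun=> 0%N)
  (fun _ _ => 0) 0 (fun=> 0) _ _ _ _ _ _).
- by case.
- by move=> i [].
- move=> f; split=> [f0 | [v]]; last first.
    by rewrite mulmx0 => /esym/rowP/(_ 0); rewrite !mxE eqxx mulr1n => ->.
  exists 0; rewrite mulmx0; apply/esym; rewrite (_ : f = 0) ?scalar_mx0 //.
    by apply: raddf0.
  by apply/mpolyP => m; rewrite mcoeff0; apply/memN_msupp_eq0/negP => /f0.
- by move=> v; rewrite mulmx0 (thinmx0 v); split=> // _; exists 0; rewrite mul0mx.
- by move=> i v; rewrite mulmx0; split=> // _; exists 0; rewrite mul0mx thinmx0.
- by move=> i [].
- by split=> [i [] | d []].
Qed.

Lemma mideal_addX (Q : 'X_{1..n} -> Prop) m : upclosed Q ->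
  [set g + h * 'X_[m] | g in (mideal Q : set S) & h in setT] =
  mideal (fun v => Q v \/ (m <= v)%MM).
Proof.
move=> uQ; apply/seteqP; split=> [_ [g Qg [h _ <-]] v | ].
  move=> /msuppDP [/Qg|]; first by left.
  move=> /msuppMP [m1 [m2 [_ /mem_msuppXP <- ->]]]; right; exact: lem_addl.
have [Q0 QD QM] := @mideal_ideal K n Q uQ.
apply: idealS => [|v [Qv|mv]].
- split=> [|_ _ [g Qg [h _ <-]] [g' Qg' [h' _ <-]]|f _ [g Qg [h _ <-]]].
  + by exists 0 => //; exists 0 => //; rewrite mul0r addr0.
  + exists (g + g'); first exact: QD.
    by exists (h + h') => //; rewrite mulrDl addrACA.
  + exists (f * g); first exact: QM.
    by exists (f * h) => //; rewrite mulrDr mulrA.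
- exists 'X_[v]; first by apply/midealX.
  by exists 0 => //; rewrite mul0r addr0.
- exists 0 => //; exists 'X_[v - m] => //.
  by rewrite add0r -mpolyXD submK.
Qed.

Lemma colon_mideal (Q : 'X_{1..n} -> Prop) m :
  colon (mideal Q : set S) 'X_[m] = mideal (fun v => Q (m + v)%MM).
Proof. by apply/seteqP; split=> f; apply midealMX. Qed.

Lemma is_homogX m : is_homog (mdeg m) ('X_[m] : S).
Proof. by move=> u /mem_msuppXP <-. Qed.

Lemma resolved_addX (Q : 'X_{1..n} -> Prop) m (F : {set 'I_n}) D :
  upclosed Q ->
  (forall v, Q (m + v)%MM <-> exists2 i, i \in F & v i != 0%N) ->
  (forall d', D d' -> (d' <= mdeg m)%N) ->
  resolved_in (mideal Q) D -> linear_resolution (varideal F) ->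
  resolved_in (mideal (fun v => Q v \/ (m <= v)%MM)) (D `|` [set mdeg m]).
Proof.
move=> uQ QF Dm QD FD; rewrite -mideal_addX //; apply: resolved_cone QD FD => //.
- exact: is_homogX.
- move=> g; have /seteqP[h1 h2] := colon_mideal Q m.
  by rewrite varidealE -(eq_mideal K QF); split=> [/h2|/h1].
- move=> f; rewrite varidealE => Pf; apply/memN_msupp_eq0/negP => /Pf [i _].
  by rewrite mnm0E.
Qed.

(** For [x] in [F], the colon of the ideal of [F :\ x] by the variable [x] is that ideal again, so a
    cone over its own resolution resolves the ideal of [F]. This builds the Koszul complex one
    variable at a time. *)
Lemma linear_resolution_varideal (F : {set 'I_n}) :
  linear_resolution (varideal F).
Proof.
(* Only an inclusion is claimed, since [D] is empty when [F] is. *)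
suff [D [G [Gshift _]] D1] : exists2 D, resolved_in (varideal F) D & D `<=` [set 1%N].
  by exists G => i p; have [d /D1 ->] := Gshift i p.
have [k] := ubnP #|F|; elim: k F => // k IHk F leFk.
have [->|[x xF]] := set_0Vmem F.
  exists set0 => //; rewrite varidealE.
  rewrite (_ : mideal _ = mideal (fun=> False)); first exact: resolved0.
  by apply: eq_mideal => m; split=> // -[i]; rewrite inE.
have ltFk : (#|F :\ x| < k)%N by rewrite (cardsD1 x) xF in leFk.
have [D FD D1] := IHk _ ltFk.
exists (D `|` [set mdeg U_(x)]); last by rewrite mdeg1 => d [/D1|].
have [G [Gshift _]] := FD.
rewrite varidealE in FD; rewrite varidealE.
rewrite (_ : mideal _ = mideal (fun v => (exists2 i, i \in F :\ x & v i != 0%N) \/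
   (U_(x) <= v)%MM)).
  apply: (resolved_addX (F := F :\ x) _ _ _ FD) => [m u [i iF mi] /mnm_lepP/(_ i)|||].
  - by move=> mu; exists i => //; rewrite -lt0n (leq_trans _ mu) // lt0n.
  - by move=> v; split=> -[i iF vi]; exists i => //; move: vi;
      rewrite mnmDE mnm1E; move: iF; rewrite in_setD1 eq_sym => /andP[/negbTE ->].
  - by move=> d /D1 ->; rewrite mdeg1.
  - by exists G => i p; have [d /D1 ->] := Gshift i p.
apply: eq_mideal => v; split=> [[i iF vi]|[[i iF vi]|]].
- have [ix|ix] := eqVneq i x; last by left; exists i; rewrite // in_setD1 ix.
  by right; rewrite lep1mP -ix.
- by exists i => //; move: iF; rewrite in_setD1 => /andP[].
- by rewrite lep1mP => vx; exists x.
Qed.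

(** The prefixes of [us] are resolved in turn, one cone per generator; nondecreasing degrees supply
    the bound that keeps the cones minimal. *)
Lemma resolved_monideal (us : seq 'X_{1..n}) :
  (forall i, (i < size us)%N -> exists F : {set 'I_n}, forall v,
     (exists2 u, u \in take i us & (u <= nth 0%MM us i + v)%MM) <->
     (exists2 x, x \in F & v x != 0%N)) ->
  (forall i j, (i <= j < size us)%N ->
     (mdeg (nth 0%MM us i) <= mdeg (nth 0%MM us j))%N) ->
  resolved_in (monideal us) [set d | exists2 u, u \in us & d = mdeg u].
Proof.
move=> usF usd.
suff H k : (k <= size us)%N -> resolved_in (monideal (take k us))
    [set d | exists2 u, u \in take k us & d = mdeg u].
  by have := H _ (leqnn _); rewrite take_size.
elim: k => [_|k IHk kus].
  rewrite take0 monidealE (_ : mideal _ = mideal (fun=> False)).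
    by rewrite (_ : mkset _ = set0) ?eqEsubset; [exact: resolved0 | split=> // d []].
  by apply: eq_mideal => m; split=> // -[u]; rewrite in_nil.
have {}IHk := IHk (ltnW kus); have [F uF] := usF _ kus.
rewrite (take_nth 0%MM kus); set m := nth _ _ _ in uF *.
rewrite monidealE in IHk; rewrite monidealE.
rewrite (_ : mideal _ = mideal (fun v => (exists2 u, u \in take k us & (u <= v)%MM) \/
  (m <= v)%MM)); last first.
  apply: eq_mideal => v; split=> [[u]|[[u ut uv]|mv]].
  - rewrite mem_rcons inE => /predU1P[->|ut] uv; first by right.
    by left; exists u.
  - by exists u; rewrite // mem_rcons inE ut orbT.
  - by exists m; rewrite // mem_rcons inE eqxx.
rewrite (_ : mkset _ =
   [set d | exists2 u, u \in take k us & d = mdeg u] `|` [set mdeg m]); last first.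
  apply/seteqP; split=> d [].
  - move=> u; rewrite mem_rcons inE => /predU1P[->|ut] ->; first by right.
    by left; exists u.
  - by move=> [u ut ->]; exists u; rewrite // mem_rcons inE ut orbT.
  - by move=> ->; exists m; rewrite // mem_rcons inE eqxx.
apply: (resolved_addX _ uF) => // [v w [u ut uv] vw | d [u ut ->] |].
- by exists u => //; exact: lepm_trans vw.
- have [j ltj <-] := nthP 0%MM ut; move: ltj; rewrite size_take kus => ltj.
  by rewrite nth_take // usd // (ltnW ltj).
- exact: linear_resolution_varideal.
Qed.

Lemma is_reg_resolved J D (r : nat) : resolved_in J D -> D r ->
  (forall d, D d -> (d <= r)%N) -> is_reg J r%:Z.
Proof.
move=> [F [Fshift Ftop]] Dr Dle; exists F; split=> [i p|].
  by have [d /Dle dr ->] := Fshift i p; lia.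
by have [p pr] := Ftop _ Dr; exists 0%N, p; rewrite pr subr0.
Qed.

End LinearQuotientsResolution.

(** * Linear quotients from an exchange property *)

Section MinimalGenerators.
Variables (n : nat).
Implicit Types (V : 'X_{1..n} -> Prop) (m u v w : 'X_{1..n}).

Definition minimal_in V u := V u /\ forall v, V v -> (v <= u)%MM -> v = u.

Lemma mdeg_lt u v : (v <= u)%MM -> v <> u -> (mdeg v < mdeg u)%N.
Proof.
move=> vu nvu; rewrite -(submK vu) mdegD -[X in (X < _)%N]add0n ltn_add2r lt0n.
by rewrite mdeg_eq0; apply/eqP => uv0; apply: nvu; rewrite -(submK vu) uv0 add0m.
Qed.

Lemma exists_minimal V m : V m -> exists2 u, minimal_in V u & (u <= m)%MM.
Proof.
have [k] := ubnP (mdeg m); elim: k m => // k IHk m leFk Vm.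
have [min|] := pselect (forall v, V v -> (v <= m)%MM -> v = m).
  by exists m; [split | exact: lepm_refl].
move=> /existsNP [v /not_implyP [Vv /not_implyP [vm nvm]]].
have [|//|u minu uv] := IHk v; first by apply: leq_trans (mdeg_lt vm nvm) _.
by exists u => //; exact: lepm_trans vm.
Qed.

Variable Phi : 'X_{1..n} -> nat.

(** The last component carries the dual order: for equal degree and equal [Phi], the larger monomial
    comes first. *)
Definition sort_key u : nat *l (nat *l 'X_{1..n}^d) := (mdeg u, (Phi u, u)).

Definition before v u := (sort_key v < sort_key u)%O.

Lemma beforeP v u : reflect
  [\/ (mdeg v < mdeg u)%N,
      mdeg v = mdeg u /\ (Phi v < Phi u)%N
    | [/\ mdeg v = mdeg u, Phi v = Phi u & (u < v)%O]]
  (before v u).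
Proof.
rewrite /before !ltxi_pair !leEnat -[(_ < _ :> 'X_{1..n}^d)%O]/(u < v)%O.
apply: (iffP idP).
  case: (ltngtP (mdeg v) (mdeg u)) => //= [|->]; first by constructor 1.
  case: (ltngtP (Phi v) (Phi u)) => //= [|->]; first by constructor 2.
  by constructor 3.
case=> [|[->]|[-> ->]]; rewrite ?leqnn //.
- by move=> h; rewrite (ltnW h) leqNgt h.
- by move=> h; rewrite (ltnW h) (leqNgt (Phi u)) h.
Qed.

Lemma before_mdeg v u : before v u -> (mdeg v <= mdeg u)%N.
Proof. by move/beforeP => [/ltnW|[->]|[->]]. Qed.

(* It suffices to find [w] in [V], not necessarily a minimal generator: a minimal generator below
   [w] either is [w] or has smaller degree. *)
Definition exchangeable V := forall u v,
  minimal_in V u -> minimal_in V v -> before v u ->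
  exists p w, [/\ V w, (w <= u + U_(p))%MM, (u p < v p)%N & before w u].

(** If an earlier [v'] divides [u] times [v], the exchange property yields [p], dividing [v], and an
    element of [V] dividing [x_p u]; a minimal generator below the latter also precedes [u]. Hence
    the colon is generated by such variables. *)
Lemma sorted_minimal_generators V r :
  (forall u, minimal_in V u -> (mdeg u <= r)%N) -> exchangeable V ->
  exists us : seq 'X_{1..n},
  [/\ uniq us, forall u, u \in us <-> minimal_in V u,
     forall i j, (i <= j < size us)%N ->
       (mdeg (nth 0%MM us i) <= mdeg (nth 0%MM us j))%N
   & forall i, (i < size us)%N -> exists F : {set 'I_n}, forall v,
       (exists2 u, u \in take i us & (u <= nth 0%MM us i + v)%MM) <->
       (exists2 x, x \in F & v x != 0%N)].
Proof.
move=> Vr exV.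
pose le v u := (sort_key v <= sort_key u)%O.
(* The degree bound [r] leaves finitely many candidates. *)
pose us := sort le [seq u <- [seq val u | u : 'X_{1..n < r.+1}] | `[< minimal_in V u >]].
have us_uniq : uniq us.
  by rewrite sort_uniq filter_uniq // map_inj_uniq ?enum_uniq //; exact: val_inj.
have usE u : u \in us <-> minimal_in V u.
  rewrite mem_sort mem_filter; split=> [/andP[/asboolP] //|minu].
  rewrite (asboolT minu); have ur : (mdeg u < r.+1)%N by exact: Vr.
  by apply/mapP; exists (BMultinom ur); rewrite ?mem_enum.
have us_sorted : sorted le us.
  by apply: sort_sorted => v u; exact: le_total.
have us_le i j : (i <= j < size us)%N -> le (nth 0%MM us i) (nth 0%MM us j).
  move=> /andP[ij js]; have := sorted_leq_nth (fun x y z => @le_trans _ _ _ _ _)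
    (fun x => lexx _) 0%MM us_sorted.
  by apply; rewrite ?inE // (leq_ltn_trans ij).
have us_before i j : (i < j < size us)%N -> before (nth 0%MM us i) (nth 0%MM us j).
  move=> /andP[ij js]; rewrite /before lt_neqAle; apply/andP; split.
    2: by apply: us_le; rewrite (ltnW ij).
  apply/eqP => -[_ _ /eqP]; rewrite nth_uniq ?(ltn_trans ij js) //.
  by rewrite (ltn_eqF ij).
exists us; split=> // [i j /andP[]|i ius].
  rewrite leq_eqVlt => /predU1P[-> //|ij js].
  by apply/before_mdeg/us_before; rewrite ij.
set u := nth _ _ _.
have minu : minimal_in V u by apply/usE; exact: mem_nth.
(* The variables whose product with [u] already lies in the ideal of the earlier generators. *)
exists [set x | `[< exists2 w, w \in take i us & (w <= u + U_(x))%MM >]]%SET => v.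
split=> [[v' v't v'u]|[x]]; last first.
  rewrite inE => /asboolP [w wt /mnm_lepP wu] vx; exists w => //.
  apply/mnm_lepP => y; apply: leq_trans (wu y) _; rewrite !mnmDE leq_add2l mnm1E.
  by case: eqP => // <-; rewrite lt0n.
have [j jt jE] := nthP 0%MM v't; move: jt; rewrite size_take ius => ji.
rewrite nth_take // in jE.
have minv' : minimal_in V v' by apply/usE; exact: mem_take v't.
have v'_u : before v' u by rewrite -jE us_before // ji.
have [p [w [Vw wu upv' w_u]]] := exV _ _ minu minv' v'_u.
have [w' minw' w'w] := exists_minimal Vw.
have w'_u : before w' u.
  have [-> //|/eqP nw'w] := eqVneq w' w.
  by apply/beforeP; constructor 1; apply: leq_trans (mdeg_lt w'w nw'w) (before_mdeg w_u).
exists p; last first.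
  by move/mnm_lepP/(_ p): v'u; rewrite mnmDE -lt0n => ?; lia.
rewrite inE; apply/asboolP; exists w'; last exact: lepm_trans wu.
have /(nthP 0%MM) [l ls lE] : w' \in us by apply/usE.
suff li : (l < i)%N.
  rewrite -lE -(nth_take _ li); apply: mem_nth; rewrite size_take ius.
  exact: li.
rewrite ltnNge; apply/negP => il.
have := us_le i l; rewrite il ls => /(_ isT); rewrite lE -/u /le leNgt.
by rewrite -/(before _ _) w'_u.
Qed.

Theorem linear_quotients_reg (K : fieldType) V r :
  upclosed V -> (forall u, minimal_in V u -> (mdeg u <= r)%N) ->
  (exists2 u, minimal_in V u & mdeg u = r) -> exchangeable V ->
  has_linear_quotients (mideal V : set {mpoly K[n]}) /\
  is_reg (mideal V : set {mpoly K[n]}) r%:Z.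
Proof.
move=> uV Vr [u0 minu0 u0r] /(sorted_minimal_generators Vr).
move=> [us [us_uniq usE us_deg us_quot]].
have VE : (mideal V : set {mpoly K[n]}) = monideal us.
  rewrite monidealE; apply: eq_mideal => m; split.
    by move/exists_minimal => [u /usE]; exists u.
  by move=> [u /usE [Vu _] /(uV _ _ Vu)].
split; last first.
  rewrite VE; apply: is_reg_resolved (resolved_monideal K us_quot us_deg) _ _.
    by exists u0 => //; apply/usE.
  by move=> _ [u /usE/Vr ? ->].
exists us; first split=> // u uus.
  rewrite monidealE => /seteqP[_ /(_ 'X_[u])].
  have [Vu minu] := (usE u).1 uus.
  case/(_ _)/midealX; first exact/midealX.
  move=> w; rewrite (mem_rem_uniq u us_uniq) inE => /andP[/eqP nwu wus].
  by move/minu => wu; apply: nwu; apply: wu; have [] := (usE w).1 wus.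
move=> i /andP[_ /us_quot [F FE]]; exists F.
by rewrite monidealE colon_mideal varidealE; apply: eq_mideal.
Qed.

End MinimalGenerators.

(** * Exponents on disjoint blocks *)

Section Blocks.
Import mathcomp.boot.fintype mathcomp.boot.finset.
Local Open Scope nat_scope.
Variables (n : nat) (BB : {set {set 'I_n}}) (d : {set 'I_n} -> nat) (k : nat).
Hypothesis trivBB : trivIset BB.
Hypothesis d_gt0 : forall B, B \in BB -> 0 < d B.
Hypothesis d_le : forall B, B \in BB -> d B <= #|B|.
Hypothesis k_gt0 : 0 < k.
Implicit Types (u v w m : 'X_{1..n}) (B F : {set 'I_n}) (x y p q : 'I_n).

Lemma leq_sum_eq (T : finType) (Q : pred T) (a b : T -> nat) :
  (forall i, Q i -> a i <= b i) -> \sum_(i | Q i) b i <= \sum_(i | Q i) a i ->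
  forall i, Q i -> a i = b i.
Proof.
move=> ab; have := leqif_sum (fun i Qi => leqif_eq (ab i Qi)).
move=> -[le_ab eq_ab] le_ba i Qi; apply/eqP; move: i Qi; apply/forall_inP.
by rewrite -eq_ab eqn_leq le_ab.
Qed.

Lemma exists_lt_sum (T : finType) (F : {set T}) (a b : T -> nat) (p : T) :
  \sum_(i in F) b i <= \sum_(i in F) a i -> p \in F -> a p < b p ->
  exists2 q, q \in F & b q < a q.
Proof.
move=> sum_ba pF abp; have [/exists_inP //|nex] := boolP [exists q in F, b q < a q].
suff abE : a p = b p by rewrite abE ltnn in abp.
apply: (leq_sum_eq _ sum_ba pF) => q qF; rewrite leqNgt; apply/negP => baq.
by case/negP: nex; apply/exists_inP; exists q.
Qed.

Lemma exists_subset_between (T : finType) (E F : {set T}) (r : nat) :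
  E \subset F -> #|E| <= r <= #|F| ->
  exists D : {set T}, [/\ D \subset F, E \subset D & #|D| = r].
Proof.
move=> EF; elim: r => [|r IHr] /andP[Er rF].
  by exists E; split=> //; apply/eqP; rewrite -leqn0.
move: Er; rewrite leq_eqVlt => /predU1P[<-|Er]; first by exists E.
have [|D [DF ED Dr]] := IHr; first by rewrite -ltnS Er ltnW.
have [x xF xD] : exists2 x, x \in F & x \notin D.
  by apply/subsetPn; apply: contraTN rF => /subset_leq_card; rewrite Dr ltnNge => ->.
exists (x |: D); rewrite subUset sub1set xF DF cardsU1 xD Dr; split=> //.
by rewrite (subset_trans ED) // subsetUr.
Qed.

Lemma block_uniq B B' x : B \in BB -> B' \in BB -> x \in B -> x \in B' -> B = B'.
Proof. by move=> hB hB' xB xB'; rewrite -(def_pblock trivBB hB xB) (def_pblock trivBB hB' xB'). Qed.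

Lemma glue_blocks (g : {set 'I_n} -> 'I_n -> nat) : exists m : 'X_{1..n},
  (forall B x, B \in BB -> x \in B -> m x = g B x) /\
  (forall x, m x != 0 -> exists2 B, B \in BB & x \in B).
Proof.
exists [multinom if x \in cover BB then g (pblock BB x) x else 0 | x < n].
split=> [B x hB xB|x]; rewrite mnmE.
  by rewrite (def_pblock trivBB hB xB); case: ifP => // /negP []; apply/bigcupP; exists B.
by case: ifP => // /bigcupP [B hB xB] _; exists B.
Qed.

Definition supported u := forall x, u x != 0 -> exists2 B, B \in BB & x \in B.

Lemma sum_blocks (f : 'I_n -> nat) : (forall x, f x != 0 -> exists2 B, B \in BB & x \in B) ->
  \sum_x f x = \sum_(B in BB) \sum_(x in B) f x.
Proof.
move=> uBB; rewrite -big_trivIset // [LHS](bigID (mem (cover BB))) /=.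
rewrite [X in _ + X = _]big1 ?addn0 // => x xBB; apply/eqP/negPn/negP => /uBB [B hB xB].
by move/bigcupP: xBB; apply; exists B.
Qed.

(** The exponent of [x_p u / x_q]. Subtraction is truncated, so statements about degrees assume
    [0 < u q]. *)
Definition swap u p q := (u - U_(q) + U_(p))%MM.

Lemma swapE u p q x : swap u p q x = u x - (q == x) + (p == x).
Proof. by rewrite !mnmE. Qed.

Lemma swap_le u p q : (swap u p q <= u + U_(p))%MM.
Proof. by apply/mnm_lepP => x; rewrite swapE mnmDE mnm1E; lia. Qed.

Lemma sum_swap u p q (Q : pred 'I_n) : Q p -> Q q -> 0 < u q ->
  \sum_(x | Q x) swap u p q x = \sum_(x | Q x) u x.
Proof.
move=> Qp Qq uq; have sum1 (y : 'I_n) : Q y -> \sum_(x | Q x) (y == x : nat) = 1.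
  move=> Qy; rewrite (bigD1 y) //= eqxx big1 // => x /andP[_ xy].
  by rewrite eq_sym (negbTE xy).
apply/eqP; rewrite -(eqn_add2r 1) -{1}(sum1 q Qq) -(sum1 p Qp) -!big_split /=.
by apply/eqP; apply: eq_bigr => x _; rewrite swapE; case: (q =P x) => [<-|]; lia.
Qed.

Lemma swap_block u p q B B' x : B \in BB -> B' \in BB -> p \in B -> q \in B ->
  B' != B -> x \in B' -> swap u p q x = u x.
Proof.
move=> hB hB' pB qB nB xB'; rewrite swapE.
case: (q =P x) => [qx|_]; first by case/eqP: nB; apply: (@block_uniq _ _ x); rewrite -?qx // qx.
case: (p =P x) => [px|_]; first by case/eqP: nB; apply: (@block_uniq _ _ x); rewrite -?px // px.
by rewrite subn0 addn0.
Qed.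

Lemma mdeg_swap u p q : 0 < u q -> mdeg (swap u p q) = mdeg u.
Proof. by move=> uq; rewrite !mdegE sum_swap. Qed.

Lemma lt_swap u p q : p < q -> 0 < u q -> (u < swap u p q)%O.
Proof.
move=> pq uq; apply/ltmcP; first by rewrite mdeg_swap.
exists p => [j jp|]; rewrite swapE.
  have -> : (q == j) = false by apply/eqP => qj; rewrite qj in pq; lia.
  have -> : (p == j) = false by apply/eqP => pj; rewrite pj in jp; lia.
  by rewrite subn0 addn0.
rewrite eqxx (_ : (q == p) = false) ?subn0 ?addn1 //.
by apply/eqP => qp; rewrite qp in pq; lia.
Qed.

(** Each of the [k] squarefree factors uses a variable at most once, hence the truncation of
    exponents at [k]. *)
Definition ordinary_exp m :=
  forall B, B \in BB -> k * d B <= \sum_(x in B) minn (m x) k.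

(** Membership in the [k]-th power of every [P_F] with [#|F| = #|B| - d B + 1], an equation written
    here without truncated subtraction. *)
Definition symbolic_exp m := forall B F, B \in BB -> F \subset B ->
  #|F| + d B = #|B|.+1 -> k <= \sum_(x in F) m x.

Lemma upclosed_ordinary : upclosed ordinary_exp.
Proof.
move=> m u Vm /mnm_lepP mu B hB; apply: leq_trans (Vm B hB) _.
by apply: leq_sum => x _; rewrite leq_min geq_minr andbT (leq_trans _ (mu x)) ?geq_minl.
Qed.

Lemma upclosed_symbolic : upclosed symbolic_exp.
Proof.
move=> m u Vm /mnm_lepP mu B F hB FB FC; apply: leq_trans (Vm B F hB FB FC) _.
exact: leq_sum.
Qed.

Lemma subU u q : u q != 0 -> (u - U_(q))%MM <> u.
Proof. by move=> uq /mnmP/(_ q); rewrite !mnmE eqxx; lia. Qed.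

Lemma sum_subU (f : nat -> nat) u q F : q \in F ->
  \sum_(x in F) f ((u - U_(q))%MM x) + f (u q) =
  \sum_(x in F) f (u x) + f (u q - 1).
Proof.
move=> qF; rewrite (bigD1 q) //= [in RHS](bigD1 q) //= !mnmE eqxx.
rewrite addnAC [RHS]addnAC [f (u q) + _]addnC; congr (_ + _).
by apply: eq_bigr => x /andP[_ xq]; rewrite !mnmE eq_sym (negbTE xq) subn0.
Qed.

(** Division by [x_q] violates the inequality of some block. That block contains [q], its inequality
    was tight, and the truncated exponent at [q] dropped, so [u q <= k]. *)
Lemma minimal_ordinary u q : minimal_in ordinary_exp u -> u q != 0 ->
  exists B, [/\ B \in BB, q \in B, u q <= k & \sum_(x in B) minn (u x) k = k * d B].
Proof.
move=> [Vu minu] uq.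
have : ~ ordinary_exp (u - U_(q)) by move=> /minu/(_ (lem_subr _ _))/(subU uq).
move=> /existsNP [B /not_implyP [hB /negP]]; rewrite -ltnNge => ltk.
have VB := Vu B hB.
have qB : q \in B.
  apply/negPn/negP => qB; move: ltk; rewrite ltnNge => /negP; apply.
  apply: leq_trans VB _; apply: leq_sum => x xB; rewrite !mnmE.
  by case: (q =P x) qB => [->|]; rewrite ?xB // subn0.
exists B; move: VB ltk (sum_subU (minn^~ k) u qB) => /= VB ltk E.
by split=> //; lia.
Qed.

Lemma minimal_symbolic u q : minimal_in symbolic_exp u -> u q != 0 ->
  exists B F, [/\ B \in BB, F \subset B, #|F| + d B = #|B|.+1, q \in F &
    \sum_(x in F) u x = k].
Proof.
move=> [Vu minu] uq.
have : ~ symbolic_exp (u - U_(q)) by move=> /minu/(_ (lem_subr _ _))/(subU uq).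
move=> /existsNP [B /existsNP [F /not_implyP [hB /not_implyP [FB /not_implyP [FC /negP]]]]].
rewrite -ltnNge => ltk; have VF := Vu B F hB FB FC.
have qF : q \in F.
  apply/negPn/negP => qF; move: ltk; rewrite ltnNge => /negP; apply.
  apply: leq_trans VF _; apply: leq_sum => x xF; rewrite !mnmE.
  by case: (q =P x) qF => [->|]; rewrite ?xF // subn0.
exists B, F; split=> //; move: VF ltk (sum_subU id u qF) => /= VF ltk E.
by lia.
Qed.

Lemma supported_ordinary u : minimal_in ordinary_exp u -> supported u.
Proof. by move=> minu q /(minimal_ordinary minu) [B [hB qB _ _]]; exists B. Qed.

Lemma supported_symbolic u : minimal_in symbolic_exp u -> supported u.
Proof.
move=> minu q /(minimal_symbolic minu) [B [F [hB /subsetP FB _ /FB qB _]]].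
by exists B.
Qed.

Lemma minimal_ordinary_le u x : minimal_in ordinary_exp u -> u x <= k.
Proof.
by move=> minu; case: (eqVneq (u x) 0) => [->|/(minimal_ordinary minu) [B []]].
Qed.

Lemma minimal_ordinary_sum u B : minimal_in ordinary_exp u -> B \in BB ->
  \sum_(x in B) u x = k * d B.
Proof.
move=> minu hB.
have minn_u x : minn (u x) k = u x by apply/minn_idPl/minimal_ordinary_le.
have := minu.1 B hB; under eq_bigr do rewrite minn_u.
(* As [k * d B] is positive, the block contains a point of the support. The tight block through that
   point is [B] by disjointness. *)
move=> leB; have: \sum_(x in B) u x != 0.
  by rewrite -lt0n (leq_trans _ leB) // muln_gt0 k_gt0 d_gt0.
rewrite sum_nat_eq0 negb_forall => /existsP [x]; rewrite negb_imply => /andP[xB].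
move=> /(minimal_ordinary minu) [B' [hB' xB' _]].
by rewrite (block_uniq hB hB' xB xB'); under eq_bigr do rewrite minn_u.
Qed.

Lemma minimal_ordinary_mdeg u : minimal_in ordinary_exp u ->
  mdeg u = k * \sum_(B in BB) d B.
Proof.
move=> minu; rewrite mdegE sum_blocks; last exact: supported_ordinary.
by rewrite big_distrr; apply: eq_bigr => B hB; exact: minimal_ordinary_sum.
Qed.

(** Degrees and block sums of minimal generators agree, so [v] precedes [u] lexicographically. Take
    the first index [p] where they differ and, in its block, some [q] with [v q < u q]; then
    [p < q]. The swap keeps exponents at most [k] because [u p < v p <= k]. *)
Lemma exchangeable_ordinary : exchangeable (fun=> 0) ordinary_exp.
Proof.
move=> u v minu minv; have Eu := minimal_ordinary_sum minu.
have Ev := minimal_ordinary_sum minv.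
have degE : mdeg u = mdeg v by rewrite !minimal_ordinary_mdeg.
case/beforeP => [|[_ //]|[_ _ /(ltmcP degE) [p pfst upv]]]; first by rewrite degE ltnn.
have [|B hB pB] := @supported_ordinary v minv p; first by rewrite -lt0n; lia.
have [q qB vq] : exists2 q, q \in B & v q < u q.
  by apply: exists_lt_sum pB upv; rewrite Eu // Ev.
have uq : 0 < u q by lia.
have pq : p < q.
  rewrite ltnNge leq_eqVlt; apply/negP => /predU1P[/val_inj qp|/pfst]; last by lia.
  by rewrite qp in vq; lia.
have swap_le_k x : swap u p q x <= k.
  rewrite swapE; have := minimal_ordinary_le x minu.
  by have := minimal_ordinary_le p minv; case: (p =P x) => [<-|]; lia.
exists p, (swap u p q); split=> //; first 1 last.
- exact: swap_le.
- by apply/beforeP; constructor 3; rewrite mdeg_swap //; split=> //; exact: lt_swap.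
- move=> B' hB'; rewrite -(Eu B' hB').
  rewrite [leqRHS](eq_bigr (swap u p q)) => [|x _]; last exact/minn_idPl.
  have [->|nB] := eqVneq B' B; first by rewrite sum_swap.
  by rewrite leq_eqVlt; apply/orP; left; apply/eqP; apply: eq_bigr => x xB';
    rewrite (swap_block _ hB hB').
Qed.

(** A point [q] of maximal exponent [M] lies in a tight face [F]. The [d B - 1] points of the block
    outside [F] also have exponent [M], so the block sum is [k + (d B - 1) M]. *)
Lemma symbolic_level u B : minimal_in symbolic_exp u -> B \in BB ->
  exists M q, [/\ q \in B, u q = M, forall x, x \in B -> u x <= M, 0 < M <= k &
    \sum_(x in B) u x = k + (d B).-1 * M].
Proof.
move=> minu hB; have Vu := minu.1; have d0 := d_gt0 hB; have dB := d_le hB.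
have [F0 [FB _ FC]] : exists D : {set 'I_n},
    [/\ D \subset B, set0 \subset D & #|D| = #|B|.+1 - d B].
  by apply: exists_subset_between; rewrite ?cards0 ?sub0set //; lia.
(* A face sum of at least [k] forces a non-zero exponent, so the maximum on the block is
   positive. *)
have k_le : k <= \sum_(x in F0) u x by apply: (Vu B) => //; rewrite FC; lia.
have [x0 x0F] : exists2 x, x \in F0 & u x != 0.
  apply/exists_inP; apply: contraTT k_le; rewrite negb_exists_in => /forall_inP u0.
  by rewrite big1 -?ltnNge // => x /u0 /negPn /eqP.
rewrite -lt0n => ux0; have x0B : x0 \in B by apply: (subsetP FB).
have [q qB qmax] : exists2 q, q \in B & forall x, x \in B -> u x <= u q.
  by case: (@arg_maxnP _ x0 (mem B) u x0B) => q qB qmax; exists q.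
have uq : 0 < u q by apply: leq_trans ux0 (qmax _ x0B).
have uq0 : u q != 0 by rewrite -lt0n.
have [B' [F [hB' FB' FC' qF sumF]]] := minimal_symbolic minu uq0.
have eB : B' = B by apply: block_uniq qB => //; exact: (subsetP FB').
move: FB' FC'; rewrite {}eB => FB' FC'.
exists (u q), q; split=> //.
  by rewrite uq -sumF (bigD1 q) //= leq_addr.
(* Otherwise trading [q] for [y] in [F] gives a face of the same size with sum below [k]. *)
have outF y : y \in B -> y \notin F -> u y = u q.
  move=> yB yF; apply/eqP; rewrite eqn_leq qmax //= leqNgt; apply/negP => uyq.
  have FyB : y |: F :\ q \subset B.
    by rewrite subUset sub1set yB (subset_trans (subD1set _ _)).
  have yFq : y \notin F :\ q by rewrite in_setD1 (negbTE yF) andbF.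
  have FyC : #|y |: F :\ q| + d B = #|B|.+1.
    by rewrite cardsU1 yFq -FC' (cardsD1 q F) qF.
  have := Vu B _ hB FyB FyC; rewrite big_setU1 //=.
  by move: sumF; rewrite (big_setD1 q) //=; lia.
rewrite (big_setID F) /= (setIidPr FB') sumF; congr (_ + _).
rewrite (eq_bigr (fun=> u q)) => [|y]; last by rewrite inE => /andP[yF yB]; exact: outF.
rewrite big_const iter_addn_0 mulnC; congr (_ * _).
rewrite cardsD (setIidPr FB'); move: FC' (subset_leq_card FB') d0 => /=.
by move: #|B| #|F| (d B) => a b c; lia.
Qed.

Lemma minimal_symbolic_mdeg_le u : minimal_in symbolic_exp u ->
  mdeg u <= k * \sum_(B in BB) d B.
Proof.
move=> minu; rewrite mdegE sum_blocks; last exact: supported_symbolic.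
rewrite big_distrr; apply: leq_sum => B hB.
have [M [q [_ _ _ /andP[_ Mk] ->]]] := symbolic_level minu hB.
have := d_gt0 hB; rewrite /=; case: (d B) => // e _; rewrite mulnS leq_add2l mulnC.
exact: leq_mul.
Qed.

Definition square_sum u := \sum_x u x ^ 2.

(** The sum of squares drops if [u p + 2 <= u q] and is unchanged if [u p + 1 = u q]; in the latter
    case the monomial order decides. *)
Lemma square_sum_swap u p q : p != q -> 0 < u q ->
  square_sum (swap u p q) + 2 * u q = square_sum u + 2 * u p + 2.
Proof.
move=> pq uq; rewrite /square_sum (bigD1 p) //= (bigD1 q) 1?eq_sym //=.
rewrite [in RHS](bigD1 p) //= [in RHS](bigD1 q) 1?eq_sym //=.
rewrite (eq_bigr (fun x => u x ^ 2)) => [|x /andP[xp xq]].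
  rewrite !swapE !eqxx (negbTE pq) eq_sym (negbTE pq).
  move: (\sum_(_ < n | _) _) => R.
  move: (u q) (u p) uq => a b; nia.
by rewrite swapE eq_sym (negbTE xq) eq_sym (negbTE xp) subn0 addn0.
Qed.

(** The block sum stays [k + (d B - 1) M] and no exponent exceeds [M]. The [d B - 1] points of the
    block outside a face carry at most [(d B - 1) M], which leaves at least [k] for the face. *)
Lemma swap_symbolic u p q B : minimal_in symbolic_exp u -> B \in BB ->
  p \in B -> q \in B -> (forall x, x \in B -> u x <= u q) -> u p < u q ->
  symbolic_exp (swap u p q).
Proof.
move=> minu hB pB qB qmax upq B' F hB' FB' FC.
have [eB|nB] := eqVneq B' B; last first.
  apply: leq_trans (minu.1 B' F hB' FB' FC) _; apply: leq_sum => x xF.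
  by rewrite (swap_block _ hB hB' pB qB nB) //; exact: (subsetP FB').
move: FB' FC; rewrite {}eB => FB FC {hB' B'}.
have [M [r [rB uM uleM _ sumB]]] := symbolic_level minu hB.
have uqM : u q = M by apply/eqP; rewrite eqn_leq uleM // -uM qmax.
have uq : 0 < u q by lia.
have := sum_swap (u := u) (p := p) (q := q) (Q := mem B) pB qB uq.
rewrite /= sumB (big_setID F) /= (setIidPr FB).
have outF : \sum_(x in B :\: F) swap u p q x <= (d B).-1 * M.
  apply: (@leq_trans (\sum_(x in B :\: F) M)).
    apply: leq_sum => x /setDP[xB _]; rewrite swapE.
    by have := uleM _ xB; case: (p =P x) => [<-|]; lia.
  rewrite sum_nat_const leq_mul2r cardsD (setIidPr FB); apply/orP; right.
  by move: FC (d_gt0 hB) => /=; move: #|B| #|F| (d B) => a b c; lia.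
by move=> E; rewrite -(leq_add2r ((d B).-1 * M)) -E leq_add2l.
Qed.

Lemma before_swap u p q : p != q -> 0 < u q ->
  u p + 2 <= u q \/ (u p).+1 = u q /\ p < q ->
  before square_sum (swap u p q) u.
Proof.
move=> pq uq; have := square_sum_swap pq uq.
case: (ltngtP (square_sum (swap u p q)) (square_sum u)) => [lt _ _|gt E|eqS E].
- by apply/beforeP; constructor 2; rewrite mdeg_swap.
- by case=> [|[]]; lia.
- case=> [|[_ ltpq]]; first by lia.
  by apply/beforeP; constructor 3; rewrite mdeg_swap // eqS; split=> //; exact: lt_swap.
Qed.

(** If no swap from a point of maximal exponent works, block sums and then block sums of squares of
    [v] are at least those of [u]. As [v] precedes [u], all are equal, and at the first index where
    [u] and [v] differ a suitable swap exists after all. *)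
Lemma exchangeable_symbolic : exchangeable square_sum symbolic_exp.
Proof.
move=> u v minu minv vu.
pose good p q := exists B, [/\ B \in BB, p \in B, q \in B,
  forall x, x \in B -> u x <= u q & u p < v p].
have [[p [q [[B [hB pB qB qmax upv]] upq]]]|nogood] := pselect (exists p q, good p q /\
    (u p + 2 <= u q \/ (u p).+1 = u q /\ p < q)).
  have ltpq : u p < u q by lia.
  exists p, (swap u p q); split=> //; [exact: (swap_symbolic minu hB pB qB) | exact: swap_le |].
  by apply: before_swap upq; [apply: contraTneq ltpq => ->; rewrite ltnn | lia].
have level B : B \in BB -> exists M, [/\ 0 < M, forall x, x \in B -> u x <= M,
    \sum_(x in B) u x <= \sum_(x in B) v x,
    forall p, p \in B -> u p < v p -> M <= (u p).+1
  & forall p q, p \in B -> q \in B -> u q = M -> u p < v p -> (u p).+1 = M -> q <= p].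
  move=> hB.
  have [M [q [qB uq uleM /andP[M0 _] sumu]]] := symbolic_level minu hB.
  have [N [r [rB vr vleN _ sumv]]] := symbolic_level minv hB.
  have upM p : p \in B -> u p < v p -> M <= (u p).+1.
    move=> pB upv; rewrite leqNgt; apply/negP => upM; apply: nogood; exists p, q.
    split; last by left; rewrite uq; lia.
    by exists B; split=> // x xB; rewrite uq uleM.
  exists M; split=> //; last first.
    move=> p q' pB qB' uq' upv upM'; rewrite leqNgt; apply/negP => ltpq.
    apply: nogood; exists p, q'; split; last by right; rewrite uq'.
    by exists B; split=> // x xB; rewrite uq' uleM.
  rewrite sumu sumv leq_add2l leq_mul2l; apply/orP; right.
  (* If the maximum [N] of [v] on [B] were below [M], then [v <= u] on [B], strictly at [q]. This
     contradicts the tight face of [u] through [q], where [v] also sums to at least [k]. *)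
  rewrite leqNgt; apply/negP => ltNM.
  have vleu x : x \in B -> v x <= u x.
    move=> xB; rewrite leqNgt; apply/negP => uxv.
    by have := upM x xB uxv; have := vleN x xB; lia.
  have uq0 : u q != 0 by rewrite uq -lt0n.
  have [B' [F [hB' FB' FC qF sumF]]] := minimal_symbolic minu uq0.
  have eB : B' = B by apply: block_uniq qB => //; exact: (subsetP FB').
  have := minv.1 _ _ hB' FB' FC; rewrite -sumF => sum_uv.
  have vuq : v q < u q by rewrite uq; apply: leq_ltn_trans ltNM; exact: vleN.
  have [x xF] := exists_lt_sum sum_uv qF vuq.
  by rewrite ltnNge vleu // -eB; exact: (subsetP FB').
have sumB : forall B, B \in BB -> \sum_(x in B) u x = \sum_(x in B) v x.
  apply: leq_sum_eq => [B /level [M []] //|].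
  rewrite -!sum_blocks; try exact: supported_symbolic.
  by rewrite -!mdegE; exact: before_mdeg vu.
have degE : mdeg v = mdeg u.
  rewrite !mdegE !sum_blocks; try exact: supported_symbolic.
  by apply: eq_bigr => B /sumB.
(* The difference of the two sides is [(v x - u x) (v x + u x - (2 M - 1))]. If [u x < v x] then
   [u x >= M - 1]; if [v x < u x] then [u x <= M]. In both cases the factors do not have opposite
   signs. *)
have sq B M : B \in BB -> 0 < M -> (forall x, x \in B -> u x <= M) ->
    (forall p, p \in B -> u p < v p -> M <= (u p).+1) ->
    forall x, x \in B -> u x ^ 2 + (2 * M).-1 * v x <= v x ^ 2 + (2 * M).-1 * u x.
  move=> hB M0 uleM upM x xB; have := uleM x xB; have := upM x xB.
  case: (ltngtP (u x) (v x)) => [uxv|vxu _|->] //.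
    move=> /(_ isT) h1 h2.
    have [e ve] : exists e, v x = u x + e by exists (v x - u x); lia.
    have : (2 * M).-1 <= 2 * u x + 1 by lia.
    rewrite ve; move: (_.-1) (u x) => N a; nia.
  move=> h; have [e ue] : exists e, u x = v x + e by exists (u x - v x); lia.
  have : 2 * v x + e <= (2 * M).-1 by lia.
  rewrite ue; move: (_.-1) (v x) => N a; nia.
have sq_sum B : B \in BB -> \sum_(x in B) u x ^ 2 <= \sum_(x in B) v x ^ 2.
  move=> hB; have [M [M0 uleM _ upM _]] := level B hB.
  rewrite -(leq_add2r ((2 * M).-1 * \sum_(x in B) u x)) {1}sumB //.
  by rewrite !big_distrr -!big_split; apply: leq_sum; exact: sq.
have sq_supp w : supported w -> square_sum w = \sum_(B in BB) \sum_(x in B) w x ^ 2.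
  move=> sw; apply: sum_blocks => x wx; apply: sw; apply: contraNneq wx => ->.
  by rewrite exp0n.
(* With equal degrees and [square_sum u <= square_sum v], only the lexicographic case of [before]
   remains. *)
have [sqE ltuv] : square_sum v = square_sum u /\ (u < v)%O.
  case/beforeP: vu => [|[_]|[]]; rewrite ?degE ?ltnn // ltnNge.
  rewrite !sq_supp; try exact: supported_symbolic.
  by rewrite leq_sum.
have sqB : forall B, B \in BB -> \sum_(x in B) u x ^ 2 = \sum_(x in B) v x ^ 2.
  apply: leq_sum_eq => //.
  by rewrite -!sq_supp ?sqE //; exact: supported_symbolic.
move/(ltmcP (esym degE)): ltuv => [p pfst upv].
have [|B hB pB] := @supported_symbolic v minv p; first by rewrite -lt0n; lia.
have [M [M0 uleM _ upM last]] := level B hB.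
(* Equality of the sums forces equality in each term, so [u x + v x = 2 M - 1] wherever [u] and [v]
   differ on [B]: one value is [M - 1] and the other is [M]. *)
have sqx : forall x, x \in B ->
    u x ^ 2 + (2 * M).-1 * v x = v x ^ 2 + (2 * M).-1 * u x.
  apply: leq_sum_eq; first exact: sq.
  by rewrite !big_split -!big_distrr /= sqB // sumB.
have upM1 : (u p).+1 = M.
  have := sqx p pB; have := upM p pB upv.
  have [e [ve e0]] : exists e, v p = u p + e /\ 0 < e by exists (v p - u p); lia.
  by rewrite ve; move: (u p) e0 => a e0 h; nia.
have [q qB vuq] : exists2 q, q \in B & v q < u q.
  by apply: exists_lt_sum pB upv; rewrite sumB.
have uqM : u q = M.
  have := sqx q qB; have := uleM q qB.
  have [e [ve e0]] : exists e, u q = v q + e /\ 0 < e by exists (u q - v q); lia.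
  by rewrite ve; move: (v q) e0 => a e0 h; nia.
have := last p q pB qB uqM upv upM1.
rewrite leq_eqVlt => /predU1P[/val_inj qp|/pfst]; last by lia.
by rewrite qp in vuq; lia.
Qed.

(** [u0] is the exponent of the [k]-th power of a squarefree generator, with [d B] variables chosen
    in every block. *)
Lemma block_tops : exists u0 : 'X_{1..n}, exists D : {set 'I_n} -> {set 'I_n},
  [/\ forall B, B \in BB -> D B \subset B /\ #|D B| = d B,
      forall B x, B \in BB -> x \in B -> u0 x = if x \in D B then k else 0
    & supported u0].
Proof.
have exD B : exists D : {set 'I_n}, B \in BB -> D \subset B /\ #|D| = d B.
  have [hB|] := boolP (B \in BB); last by exists B.
  have [|D [DB _ DC]] := @exists_subset_between _ set0 B (d B) (sub0set _).
    by rewrite cards0 /= d_le.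
  by exists D.
have [D DP] := choice exD.
have [u0 [u0E su0]] := glue_blocks (fun B x => if x \in D B then k else 0).
by exists u0, D; split.
Qed.

Lemma exists_ordinary : exists m, ordinary_exp m.
Proof.
have [u [D [DP uE _]]] := block_tops; exists u => B hB.
have [DB <-] := DP B hB; rewrite mulnC -sum_nat_const [leqRHS](big_setID (D B)) /=.
rewrite (setIidPr DB) (leq_trans _ (leq_addr _ _)) //; apply: leq_sum => x xD.
by rewrite (uE B x hB (subsetP DB _ xD)) xD minnn.
Qed.

(** Every face meets [D B] by cardinality, so [u] lies in the ideal. For [x] in [D B], the face
    [x |: (B :\: D B)] meets [D B] only in [x], which forces exponent [k] there and gives
    minimality. *)
Lemma exists_minimal_symbolic_top :
  exists2 u, minimal_in symbolic_exp u & mdeg u = k * \sum_(B in BB) d B.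
Proof.
have [u [D [DP uE su]]] := block_tops; exists u; last first.
  rewrite mdegE sum_blocks // big_distrr; apply: eq_bigr => B hB /=.
  have [DB <-] := DP B hB; rewrite mulnC -sum_nat_const [LHS](big_setID (D B)) /=.
  rewrite (setIidPr DB) [X in _ + X]big1 ?addn0 => [|x /setDP[xB xD]].
    by apply: eq_bigr => x xD; rewrite (uE B x hB (subsetP DB _ xD)) xD.
  by rewrite (uE B x hB xB) (negbTE xD).
split=> [B F hB FB FC|v Vv /mnm_lepP vu].
  have [DB DC] := DP B hB.
  have [x xF xD] : exists2 x, x \in F & x \in D B.
    apply/exists_inP; apply: contraT; rewrite negb_exists_in => /forall_inP FD.
    have FBD : F \subset B :\: D B.
      by apply/subsetP => x xF; rewrite inE FD //=; exact: (subsetP FB).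
    have := subset_leq_card FBD; rewrite cardsD (setIidPr DB) DC.
    by move: FC (d_le hB) => /=; move: #|B| #|F| (d B) => a b c; lia.
  by rewrite (bigD1 x) //= (uE B x hB (subsetP FB _ xF)) xD leq_addr.
apply/mnmP => x; apply/eqP; rewrite eqn_leq vu /=.
have [->//|/su [B hB xB]] := eqVneq (u x) 0.
rewrite (uE B x hB xB); case: ifP => // xD.
have [DB DC] := DP B hB.
have xBD : x \notin B :\: D B by rewrite inE xD.
have := Vv B (x |: (B :\: D B)) hB.
rewrite subUset sub1set xB subsetDl cardsU1 xBD cardsD (setIidPr DB) DC.
rewrite big_setU1 //= big1 ?addn0 => [|y /setDP[yB yD]].
  by apply=> //; move: (d_le hB) => /=; move: #|B| (d B) => a b; lia.
by apply/eqP; rewrite -leqn0 (leq_trans (vu y)) // (uE B y hB yB) (negbTE yD).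
Qed.

End Blocks.

(** * Linear quotients and regularity of the two ideals *)

Section Ideals.
Variables (K : fieldType) (n : nat) (BB : {set {set 'I_n}}) (d : {set 'I_n} -> nat).
Hypothesis trivBB : finset.trivIset BB.
Hypothesis d_gt0 : forall B, B \in BB -> (0 < d B)%N.
Hypothesis d_le : forall B, B \in BB -> (d B <= #|B|)%N.
Local Notation S := {mpoly K[n]}.
Local Notation ordinary_ideal k := (mideal (ordinary_exp BB d k) : set S).
Local Notation symbolic_ideal k := (mideal (symbolic_exp BB d k) : set S).

Lemma ordinary_linear_quotients_reg k : (0 < k)%N ->
  has_linear_quotients (ordinary_ideal k) /\
  is_reg (ordinary_ideal k) (k * \sum_(B in BB) d B)%N%:Z.
Proof.
move=> k0; apply: linear_quotients_reg (exchangeable_ordinary trivBB d_gt0 k0).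
- exact: upclosed_ordinary.
- by move=> u /(minimal_ordinary_mdeg trivBB d_gt0 k0) ->.
- have [m /exists_minimal [u minu _]] := exists_ordinary k trivBB d_le.
  by exists u => //; exact: minimal_ordinary_mdeg.
Qed.

Lemma symbolic_linear_quotients_reg k : (0 < k)%N ->
  has_linear_quotients (symbolic_ideal k) /\
  is_reg (symbolic_ideal k) (k * \sum_(B in BB) d B)%N%:Z.
Proof.
move=> k0; apply: linear_quotients_reg (exchangeable_symbolic trivBB d_gt0 d_le k0).
- exact: upclosed_symbolic.
- by move=> u; exact: minimal_symbolic_mdeg_le.
- exact: exists_minimal_symbolic_top.
Qed.

End Ideals.

(** * Ordinary and symbolic powers *)

Section FaceOrder.
Variables (K : fieldType) (n : nat).
Local Notation S := {mpoly K[n]}.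
Implicit Types (f g s : S) (F : {set 'I_n}) (k : nat).

(** The [k]-th power of the prime [P_F], described by exponents. *)
Definition face_power F k : set S :=
  mideal (fun m => (k <= \sum_(x in F) m x)%N).

Lemma varideal_face F : varideal F = face_power F 1.
Proof.
rewrite varidealE; apply: eq_mideal => m; split=> [[x xF mx]|].
  by rewrite (bigD1 x) //= addn_gt0 lt0n mx.
rewrite lt0n sum_nat_eq0 => /forall_inPn [x xF mx]; first by exists x.
Qed.

Lemma face_power_ideal F k : is_ideal (face_power F k).
Proof.
apply: mideal_ideal => m u km /mnm_lepP mu; apply: leq_trans km _.
exact: leq_sum.
Qed.

(* Compare the parts of least degree in the variables of [F]. *)
Lemma face_power_primary F k f s :
  face_power F k (f * s) -> ~ face_power F 1 s -> face_power F k f.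
Proof.
pose w (m : 'X_{1..n}) := (\sum_(x in F) m x)%N.
pose wz m := (w m)%:Z.
have wD m u : wz (m + u)%MM = wz m + wz u.
  rewrite /wz /w -PoszD -big_split /=; congr Posz.
  by apply: eq_bigr => x _; rewrite mnmDE.
move=> fs_k s_1; apply: contrapT => /existsNP [m0 /not_implyP [m0f /negP]].
rewrite -ltnNge => m0k.
have exr : exists r, has (fun m => w m == r) (msupp f).
  by exists (w m0); apply/hasP; exists m0.
case: (ex_minnP exr) => r /hasP [m1 m1f /eqP m1r] rmin.
have rk : (r < k)%N.
  by apply: leq_ltn_trans m0k; apply: rmin; apply/hasP; exists m0.
move: s_1 => /existsNP [m2 /not_implyP [m2s /negP]]; rewrite -ltnNge ltnS leqn0 => /eqP m20.
have lowpart (e : nat) g (m : 'X_{1..n}) : m \in msupp (g - wpart wz e%:Z g) ->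
    m \in msupp g /\ w m <> e.
  rewrite !mcoeff_msupp mcoeffB mcoeff_wpart.
  case: (wz m =P e%:Z) => [_|ne]; first by rewrite subrr eqxx.
  by rewrite subr0 => ->; split=> // wm; apply: ne; rewrite /wz wm.
(* This product of lowest components is the component of [F]-degree [r] of [f * s], which vanishes
   because [r < k]; yet neither factor is zero. *)
have fs0 : wpart wz r%:Z f * wpart wz 0 s = 0.
  have -> : wpart wz r%:Z f * wpart wz 0 s = wpart wz r%:Z (f * s).
    rewrite -[in RHS](subrK (wpart wz 0 s) s) mulrDr raddfD /= [X in X + _]wpart_eq0.
      rewrite add0r -[r%:Z in RHS]addr0; apply/esym/wpartM => //.
      by move=> m /msupp_wpart.
    move=> m /msuppMP [u1 [u2 [u1f /lowpart [_ u2_0] ->]]] /eqP.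
    have : (r <= w u1)%N by apply: rmin; apply/hasP; exists u1.
    by rewrite wD /wz; lia.
  by apply: wpart_eq0 => m /fs_k; rewrite -/(w m) /wz; lia.
move/eqP: fs0; rewrite mulf_eq0 => /orP[] /eqP /mpolyP.
- move/(_ m1)/eqP; rewrite mcoeff_wpart /wz m1r eqxx mcoeff0 mcoeff_eq0.
  by rewrite m1f.
- move/(_ m2)/eqP; rewrite mcoeff_wpart /wz /w m20 eqxx mcoeff0 mcoeff_eq0.
  by rewrite m2s.
Qed.

Lemma varideal_prime F : is_prime (varideal F : set S).
Proof.
rewrite varideal_face; split=> [||f g fg]; first exact: face_power_ideal.
  move=> /(_ 0%MM); rewrite msupp1 mem_head big1 => [/(_ isT) //|x _].
  by rewrite mnm0E.
have [gF|gF] := pselect (face_power F 1 g); first by right.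
by left; apply: face_power_primary fg gF.
Qed.

End FaceOrder.

(** * Exponents of powers, associated primes and symbolic powers *)

Section Powers.
Import mathcomp.boot.fintype mathcomp.boot.finset.
Variables (K : fieldType) (n : nat) (BB : {set {set 'I_n}}) (d : {set 'I_n} -> nat).
Hypothesis trivBB : trivIset BB.
Hypothesis d_gt0 : forall B, B \in BB -> (0 < d B)%N.
Hypothesis d_le : forall B, B \in BB -> (d B <= #|B|)%N.
Local Notation S := {mpoly K[n]}.
Local Notation ordinary_ideal k := (mideal (ordinary_exp BB d k) : set S).
Local Notation symbolic_ideal k := (mideal (symbolic_exp BB d k) : set S).
Implicit Types (m : 'X_{1..n}) (B F : {set 'I_n}).

Section Exponents.
Local Open Scope nat_scope.

(** Splits off one squarefree factor on the block. Exponents above [k] should be lowered first, so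
    [D] is compared with the set [E1] of their positions. *)
Lemma ordinary_exp_split k m B : B \in BB -> ordinary_exp BB d k.+1 m ->
  exists D : {set 'I_n}, [/\ D \subset B, #|D| = d B, forall x, x \in D -> 0 < m x
    & k * d B <= \sum_(x in B) minn (m x - (x \in D)) k].
Proof.
move=> hB /(_ B hB) Vm.
pose E1 := [set x in B | k < m x]; pose E2 := [set x in B | 0 < m x].
have E12 : E1 \subset E2 by apply/subsetP => x; rewrite !inE; case: (x \in B) => //=; lia.
have E2B : E2 \subset B by apply/subsetP => x; rewrite inE => /andP[].
(* If [E1] is large enough, [D] is taken inside it, and the points of [D] alone still contribute [k]
   each. Otherwise [D] lies between [E1] and the support [E2], and each truncated exponent drops by
   at most the indicator of [D]. *)
have [dE1|E1d] := leqP (d B) #|E1|.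
  have [|D [DE1 _ DC]] := @exists_subset_between _ set0 E1 (d B) (sub0set _).
    by rewrite cards0.
  have DE2 := subset_trans DE1 E12; have DB := subset_trans DE2 E2B.
  exists D; split=> // [x /(subsetP DE2)|]; first by rewrite inE => /andP[].
  rewrite -DC mulnC -sum_nat_const [leqRHS](big_setID D) /= (setIidPr DB).
  rewrite (leq_trans _ (leq_addr _ _)) //; apply: leq_sum => x xD.
  by rewrite xD; move/subsetP/(_ x xD): DE1; rewrite inE => /andP[_]; lia.
have dE2 : d B <= #|E2|.
  rewrite -(leq_pmul2l (ltn0Sn k)) (leq_trans Vm) // mulnC -sum_nat_const.
  rewrite (big_setID E2) /= (setIidPr E2B) [X in _ + X]big1 ?addn0.
    by apply: leq_sum => x _; exact: geq_minr.
  by move=> x; rewrite !inE; case: (x \in B) => /andP[] //=; lia.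
have [|D [DE2 ED DC]] := exists_subset_between (r := d B) E12; first by rewrite ltnW.
have DB := subset_trans DE2 E2B; exists D; split=> // [x /(subsetP DE2)|].
  by rewrite inE => /andP[].
have sumD : \sum_(x in B) (x \in D : nat) = d B.
  rewrite -DC -sum1_card (big_setID D) /= (setIidPr DB) [X in _ + X]big1 ?addn0.
    by apply: eq_bigr => x ->.
  by move=> x /setDP[_ /negbTE ->].
rewrite -(leq_add2r (d B)) addnC -mulSn (leq_trans Vm) // -{1}sumD -big_split.
apply: leq_sum => x xB /=; case: (boolP (x \in D)) => xD.
  by move/subsetP/(_ x xD): DE2; rewrite inE => /andP[_]; lia.
have : x \notin E1 by apply: contraNN xD; exact: (subsetP ED).
by rewrite inE xB /=; lia.
Qed.

Lemma card_face_compl B F : F \subset B -> #|F| + d B = #|B|.+1 ->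
  #|B :\: F| = (d B).-1.
Proof.
move=> FB; rewrite cardsD (setIidPr FB); move: (subset_leq_card FB) => /=.
by move: #|B| #|F| (d B) => a b c; lia.
Qed.

(** The [d B - 1] points of the block outside [F] contribute at most [k] each, so [k] remains for
    [F]. Hence [I^k] lies in the [k]-th power of [P_F]. *)
Lemma ordinary_exp_face k m B F : ordinary_exp BB d k m -> B \in BB ->
  F \subset B -> #|F| + d B = #|B|.+1 -> k <= \sum_(x in F) m x.
Proof.
move=> Vm hB FB FC; have := Vm B hB; rewrite (big_setID F) /= (setIidPr FB).
have := card_face_compl FB FC; have d0 := d_gt0 hB => BFC.
have outF : \sum_(x in B :\: F) minn (m x) k <= (d B).-1 * k.
  by rewrite -BFC -sum_nat_const; apply: leq_sum => x _; exact: geq_minr.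
have inF : \sum_(x in F) minn (m x) k <= \sum_(x in F) m x.
  by apply: leq_sum => x _; exact: geq_minl.
have dk : k * d B = k + (d B).-1 * k by case: (d B) d0 => // e _; rewrite mulnS mulnC.
by move=> le; rewrite -(leq_add2r ((d B).-1 * k)) -dk (leq_trans le) // leq_add.
Qed.

(** The [k]-th power of the product of the variables outside [F] is a multiplier outside [P_F]. It
    fills all other blocks and contributes [(d B - 1) k] in [B]. *)
Lemma ordinary_exp_add_face k m B F : B \in BB -> F \subset B ->
  #|F| + d B = #|B|.+1 -> k <= \sum_(x in F) m x ->
  ordinary_exp BB d k ([multinom if x \in F then 0 else k | x < n] + m)%MM.
Proof.
move=> hB FB FC km B' hB'.
have out (E : {set 'I_n}) : (forall x, x \in E -> x \notin F) ->
    #|E| * k <= \sum_(x in E)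
       minn (([multinom if x \in F then 0 else k | x < n] + m)%MM x) k.
  move=> EF; rewrite -sum_nat_const; apply: leq_sum => x /EF xF.
  by rewrite mnmDE mnmE (negbTE xF); lia.
have [->|nB] := eqVneq B' B; last first.
  rewrite (leq_trans _ (out _ _)) ?[_ * k]mulnC ?leq_mul2l ?d_le ?orbT // => x xB'.
  apply: contra nB => xF; apply/eqP.
  exact: (block_uniq trivBB hB' hB xB' (subsetP FB x xF)).
rewrite (big_setID F) /= (setIidPr FB).
have dk : k * d B = k + (d B).-1 * k.
  by case: (d B) (d_gt0 hB) => // e _; rewrite mulnS mulnC.
rewrite dk -(card_face_compl FB FC) leq_add //; last first.
  by apply: out => x /setDP[].
rewrite (eq_bigr (fun x => minn (m x) k)) => [|x xF]; last by rewrite mnmDE mnmE xF.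
(* One exponent of at least [k] on [F] suffices alone; otherwise truncation changes nothing on
   [F]. *)
have [/exists_inP [x xF kx]|] := boolP [exists x in F, k <= m x].
  by rewrite (bigD1 x) //= (leq_trans _ (leq_addr _ _)) // leq_min kx leqnn.
rewrite negb_exists_in => /forall_inP mk.
by rewrite (eq_bigr (fun x => m x)) // => x /mk; lia.
Qed.

End Exponents.

(** For the induction step, the sets split off in the blocks are glued to one squarefree exponent
    [s]. *)
Lemma idpow_ordinary k : idpow (ordinary_ideal 1) k = ordinary_ideal k.
Proof.
elim: k => [|k IHk].
  by rewrite /idpow /= -mideal_setT; apply: eq_mideal => m; split.
rewrite [LHS]/(idmul _ (idpow _ _)) IHk; apply: idmul_mideal => [|m u Vm Vu B hB|m Vm].
- exact: upclosed_ordinary.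
- rewrite mulSn -{1}[d B]mul1n (leq_trans (leq_add (Vm B hB) (Vu B hB))) //.
  by rewrite -big_split; apply: leq_sum => x _ /=; rewrite mnmDE; lia.
- have exD B : exists D : {set 'I_n}, B \in BB ->
      [/\ D \subset B, #|D| = d B, forall x, x \in D -> (0 < m x)%N
      & (k * d B <= \sum_(x in B) minn (m x - (x \in D)) k)%N].
    have [hB|] := boolP (B \in BB); last by exists B.
    by have [D DP] := ordinary_exp_split hB Vm; exists D.
  have [D DP] := choice exD.
  have [s [sE ssup]] := glue_blocks trivBB (fun B x => x \in D B).
  exists s, (m - s)%MM; split=> [B hB|B hB|].
  + have [DB <- _ _] := DP B hB.
    rewrite mul1n -sum1_card [leqRHS](big_setID (D B)) /= (setIidPr DB).
    rewrite (leq_trans _ (leq_addr _ _)) //; apply: leq_sum => x xD.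
    by rewrite (sE B x hB (subsetP DB _ xD)) xD.
  + have [_ _ _ le] := DP B hB; rewrite (leq_trans le) //; apply: leq_sum => x xB.
    by rewrite mnmBE (sE B x hB xB).
  + rewrite addmC submK //; apply/mnm_lepP => x.
    have [->//|/ssup [B hB xB]] := eqVneq (s x) 0%N.
    by rewrite (sE B x hB xB); case: (boolP (x \in D B)) => // xD; have [_ _ /(_ x xD)] := DP B hB.
Qed.

Lemma Ass_face B F : B \in BB -> F \subset B -> (#|F| + d B = #|B|.+1)%N ->
  Ass (ordinary_ideal 1) (varideal F).
Proof.
move=> hB FB FC; split; first exact: varideal_prime.
(* The product of the variables outside [F] has annihilator [P_F] modulo [I]. *)
exists 'X_[[multinom if x \in F then 0%N else 1%N | x < n]].
rewrite colon_mideal varideal_face; apply: eq_mideal => v; split.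
  exact: (ordinary_exp_add_face hB FB FC).
move=> /ordinary_exp_face /(_ hB FB FC) /leq_trans; apply.
by apply: leq_sum => x xF; rewrite mnmDE mnmE xF.
Qed.

(** Some term of [f] violates a block inequality, so its exponent vanishes on a face [F] and [f] is
    outside [P_F]. If [g * f] lies in [I], and so in [P_F], then [g] lies in [P_F]. The inclusion
    suffices below, since a denominator outside [P_F] is outside [P]. *)
Lemma Ass_sub_face P : Ass (ordinary_ideal 1) P -> exists B F,
  [/\ B \in BB, F \subset B, (#|F| + d B = #|B|.+1)%N & P `<=` face_power F 1].
Proof.
move=> [[_ P1 _] [f Pf]].
have : ~ ordinary_ideal 1 f by move=> If; apply: P1; rewrite Pf /colon /= mul1r.
move=> /existsNP [m /not_implyP [mf /existsNP [B /not_implyP [hB /negP]]]].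
rewrite -ltnNge mul1n => ltd.
pose Z := [set x in B | m x == 0%N].
have ZB : Z \subset B by apply/subsetP => x; rewrite inE => /andP[].
have cardZ : (#|B| < #|Z| + d B)%N.
  have : (#|B :\: Z| <= \sum_(x in B) minn (m x) 1)%N.
    rewrite -sum1_card [leqRHS](big_setID Z) /= (leq_trans _ (leq_addl _ _)) //.
    by apply: leq_sum => x; rewrite !inE; case: (x \in B) => //=; lia.
  rewrite cardsD (setIidPr ZB); move: (subset_leq_card ZB) ltd => /=.
  by move: #|B| #|Z| (d B) (\sum_(x in B) _) => a b c e; lia.
have [|F [FZ _ FC]] := @exists_subset_between _ set0 Z (#|B|.+1 - d B) (sub0set _).
  by rewrite cards0 /= leq_subLR addnC.
have FB := subset_trans FZ ZB.
have FC' : (#|F| + d B = #|B|.+1)%N by rewrite FC subnK // leqW ?d_le.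
exists B, F; split=> // g; rewrite Pf => gf.
apply: (@face_power_primary _ _ _ _ _ f).
  by move=> u /gf /ordinary_exp_face /(_ hB FB FC').
move=> /(_ m mf); rewrite big1 // => x /(subsetP FZ); rewrite inE.
by case/andP=> _ /eqP.
Qed.

(** One inclusion localizes at the primes [P_F] and uses that their powers are primary. For the
    other, the multiplier of [ordinary_exp_add_face] is the denominator. *)
Lemma symbolic_power_ordinary k :
  symbolic_power (ordinary_ideal 1) k = symbolic_ideal k.
Proof.
apply/seteqP; split=> f.
  move=> fsym m mf B F hB FB FC.
  have [a aI [s sP /eqP]] := fsym _ (Ass_face hB FB FC).
  have s0 : s != 0.
    by apply/eqP => s0; apply: sP; rewrite s0 varideal_face; case: (face_power_ideal K F 1).
  rewrite eq_sym -[_ == _]/(tofrac f == _).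
  have s0' : tofrac s != 0 by rewrite tofrac_eq0.
  rewrite -(can2_eq (mulfK s0') (mulfVK s0')) -tofracM tofrac_eq => /eqP fsa.
  rewrite idpow_ordinary in aI.
  have fsk : face_power F k (f * s).
    by rewrite fsa => u /aI Iu; exact: (ordinary_exp_face Iu hB FB FC).
  have s1 : ~ face_power F 1 s by rewrite -varideal_face.
  exact: (face_power_primary fsk s1 mf).
move=> fI P /Ass_sub_face [B [F [hB FB FC PF]]].
exists (f * 'X_[[multinom if x \in F then 0%N else k | x < n]]).
  rewrite idpow_ordinary; apply/midealMX => m mf.
  exact: (ordinary_exp_add_face hB FB FC (fI m mf B F hB FB FC)).
exists 'X_[[multinom if x \in F then 0%N else k | x < n]].
  move=> /PF/midealX; rewrite big1 // => x xF; by rewrite mnmE xF.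
by rewrite tofracM mulfK // tofrac_eq0 -msupp_eq0 msuppX.
Qed.

End Powers.

(** * Matching-matroidal ideals of Veronese type *)

Section MatchingMatroidal.
Import mathcomp.boot.fintype mathcomp.boot.finset.
Variables (K : fieldType) (n t : nat) (A : 'I_t -> {set 'I_n}).
Hypothesis A_veronese : veronese_type A.
Local Notation S := {mpoly K[n]}.
Implicit Types (m : 'X_{1..n}) (B : {set 'I_n}).

Definition blocks : {set {set 'I_n}} := [set A i | i in 'I_t].

Definition multiplicity B : nat := #|[set i | A i == B]|.

Lemma sum_multiplicity B : (\sum_i (A i == B) = multiplicity B)%N.
Proof.
rewrite /multiplicity -sum1_card [RHS]big_mkcond; apply: eq_bigr => i _.
by rewrite inE; case: (A i == B).
Qed.

Lemma blocks_trivIset : trivIset blocks.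
Proof.
apply/trivIsetP => _ _ /imsetP[i _ ->] /imsetP[j _ ->]; rewrite -setI_eq0.
by apply: contraNT => /(A_veronese.2 i j) ->.
Qed.

Lemma multiplicity_gt0 B : B \in blocks -> (0 < multiplicity B)%N.
Proof. by move=> /imsetP[i _ ->]; apply/card_gt0P; exists i; rewrite inE. Qed.

Lemma idmul_prod_sub (r : seq 'I_t) B : B \in blocks ->
  \big[@idmul K n/classical_sets.setT]_(i <- r) varideal (A i) `<=`
  face_power B (\sum_(i <- r) (A i == B)).
Proof.
move=> hB; elim: r => [|i r IHr].
  by rewrite !big_nil => f _ m _.
rewrite !big_cons; apply: idgen_min; first exact: face_power_ideal.
move=> _ [f fi [g /IHr gr <-]] m /msuppMP [m1 [m2 [m1f /gr h2 ->]]].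
rewrite (eq_bigr (fun x => (m1 x + m2 x)%N)) => [|x _]; last exact: mnmDE.
rewrite big_split leq_add //; case: (A i =P B) => // AB.
by rewrite varideal_face AB in fi; exact: fi.
Qed.

Lemma idmul_prodX (r : seq 'I_t) (s : 'I_t -> 'I_n) : (forall i, s i \in A i) ->
  (\big[@idmul K n/classical_sets.setT]_(i <- r) varideal (A i)) 'X_[\sum_(i <- r) U_(s i)].
Proof.
move=> sA; elim: r => [|i r IHr]; first by rewrite big_nil.
rewrite !big_cons mpolyXD; apply: sub_idgen.
exists 'X_(s i); last by exists 'X_[\sum_(j <- r) U_(s j)].
by apply: sub_idgen; exists (s i) => //=.
Qed.

(** Equal or disjoint sets admit an explicit system of distinct representatives: the [j]-th index
    among those with the same set takes the [j]-th point of the support of [m] in that set. *)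
Lemma matching m : ordinary_exp blocks multiplicity 1 m ->
  exists2 s : 'I_t -> 'I_n, injective s & forall i, s i \in A i /\ m (s i) != 0%N.
Proof.
move=> Vm.
pose L i := enum [set x in A i | m x != 0%N].
pose idx i := index i (enum [set j | A j == A i]).
have [x0 _] := choice (fun i => set0Pn _ (A_veronese.1 i)).
have idxL i : (idx i < size (L i))%N.
  rewrite -cardE (@leq_trans (multiplicity (A i))) //.
    by rewrite /multiplicity [X in (_ < X)%N]cardE index_mem mem_enum inE.
  rewrite -[multiplicity _]mul1n (leq_trans (Vm (A i) _)) ?imset_f //.
  rewrite -sum1_card [X in (_ <= X)%N](eq_bigl (fun x => (x \in A i) && (m x != 0%N))).
    rewrite [leqRHS]big_mkcondr; apply: leq_sum => x _ /=.
    by case: (m x).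
  by move=> x; rewrite inE.
have sP i : nth (x0 i) (L i) (idx i) \in [set x in A i | m x != 0%N].
  by have := mem_nth (x0 i) (idxL i); rewrite mem_enum.
exists (fun i => nth (x0 i) (L i) (idx i)) => [i j eij|i]; last first.
  by apply/andP; have := sP i; rewrite inE.
have Aij : A i = A j.
  apply: A_veronese.2; apply/set0Pn; exists (nth (x0 i) (L i) (idx i)).
  by rewrite inE; have := sP i; have := sP j; rewrite -eij !inE => /andP[-> _] /andP[-> _].
have Lij : L i = L j by rewrite /L Aij.
move: eij; rewrite (set_nth_default (x0 i) (x0 j) (idxL j)) Lij => /eqP.
rewrite nth_uniq ?enum_uniq -?Lij // ?Lij //.
rewrite /idx Aij => /eqP eidx; rewrite -(nth_index i (_ : i \in enum [set k | A k == A j])).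
  rewrite eidx nth_index // mem_enum inE //.
by rewrite mem_enum inE Aij.
Qed.

Lemma is_ideal_prod (r : seq 'I_t) :
  is_ideal (\big[@idmul K n/classical_sets.setT]_(i <- r) varideal (A i)).
Proof.
by case: r => [|i r]; [rewrite big_nil | rewrite big_cons; exact: idgen_ideal].
Qed.

(** For a squarefree monomial, the degree in a block counts the support there. Conversely, distinct
    representatives give a squarefree monomial of the product that divides [m'], the squarefree
    monomial with the support of [m]. *)
Lemma squarefree_part_prod :
  squarefree_part (\big[@idmul K n/classical_sets.setT]_(i < t) varideal (A i)) =
  mideal (ordinary_exp blocks multiplicity 1).
Proof.
apply: idgen_mideal => [|f [Lm [m m1 fE]]|m Vm].
- exact: upclosed_ordinary.
- rewrite fE in Lm *; apply/midealX => B hB; rewrite mul1n; have := idmul_prod_sub hB Lm.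
  move/midealX; rewrite sum_multiplicity => /leq_trans; apply.
  by apply: leq_sum => x _; have := m1 x; lia.
- pose m' := [multinom minn (m x) 1 | x < n].
  have [s s_inj sA] := matching Vm.
  have sm' : (\sum_i U_(s i) <= m')%MM.
    apply/mnm_lepP => x; rewrite mnm_sumE mnmE.
    have [/imsetP[i _ ->]|xs] := boolP (x \in [set s i | i in 'I_t]).
      rewrite (bigD1 i) //= big1 ?addn0 => [|j ji]; rewrite mnm1E ?eqxx.
        by have [_] := sA i; lia.
      by apply/eqP; rewrite eqb0; apply: contra ji => /eqP/s_inj ->.
    rewrite big1 // => i _; rewrite mnm1E; apply/eqP; rewrite eqb0.
    by apply: contra xs => /eqP <-; rewrite imset_f.
  have m'm : (m' <= m)%MM by apply/mnm_lepP => x; rewrite mnmE geq_minl.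
  have [_ _ idM] := idgen_ideal [set f | (\big[@idmul K n/classical_sets.setT]_(i < t)
    varideal (A i)) f /\ exists2 m : 'X_{1..n}, (forall i, (m i <= 1)%N) & f = 'X_[m]]%classic.
  rewrite -(submK m'm) mpolyXD; apply: idM; apply: sub_idgen; split; last first.
    by exists m' => // x; rewrite mnmE geq_minr.
  have [_ _ prodM] := is_ideal_prod (index_enum 'I_t).
  rewrite -(submK sm') mpolyXD; apply: prodM; apply: idmul_prodX => i.
  by have [] := sA i.
Qed.

End MatchingMatroidal.

Theorem theorem4p6 (K : fieldType) (n : nat) (I : set {mpoly K[n]})
    (I_mmv : matching_matroidal_veronese I) (I_neq0 : I <> [set 0])
    (k : nat) (k_ge1 : (1 <= k)%N) :
  has_linear_quotients (symbolic_power I k) /\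
  exists r : int, is_reg (symbolic_power I k) r /\ is_reg (idpow I k) r.
Proof.
have [t [A [A_veronese]]] := I_mmv.
rewrite squarefree_part_prod // => IE.
set d := multiplicity A in IE; set BB := blocks A in IE.
have trivBB : finset.trivIset BB := blocks_trivIset A_veronese.
have d_gt0 B : B \in BB -> (0 < d B)%N by exact: multiplicity_gt0.
(* A block with fewer points than its multiplicity would leave no admissible exponent, making [I]
   zero. *)
have d_le B : B \in BB -> (d B <= #|B|)%N.
  move=> hB; apply: contrapT => /negP dB; apply: I_neq0.
  apply/seteqP; split=> [f|_ ->]; last first.
    by rewrite IE => m; rewrite msupp0.
  rewrite IE => fI; apply/mpolyP => m; rewrite mcoeff0.
  apply/memN_msupp_eq0; apply: contraNN dB => /fI/(_ B hB).
  rewrite mul1n => /leq_trans -> //; rewrite -sum1_card.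
  by apply: leq_sum => x _; exact: geq_minr.
rewrite IE symbolic_power_ordinary // idpow_ordinary //.
have [lq reg_sym] := symbolic_linear_quotients_reg K trivBB d_gt0 d_le k_ge1.
have [_ reg_ord] := ordinary_linear_quotients_reg K trivBB d_gt0 d_le k_ge1.
by split=> //; eexists; split; [exact: reg_sym | exact: reg_ord].
Qed.
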